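(* For every integer $k\ge 4$ there exists a constant $c_0>0$ such that for all sufficiently large integers $t$, $$\pi_{k-2}(K_t^k)\ \le\ 1-\frac{c_0\log\log t}{t^{k-1}} .$$
   Context: A $k$-graph is a $k$-uniform hypergraph. $K_t^k$ is the complete $k$-graph on $t$ vertices (all $k$-subsets of a $t$-set are edges). For a $k$-graph $H$ and $0\le\ell\le k-1$, $\delta_\ell(H)$ is the minimum, over all $\ell$-subsets $S$ of $V(H)$, of the number of edges of $H$ containing $S$. For a $k$-graph $F$, $\mathrm{ex}_\ell(n,F)$ is the maximum of $\delta_\ell(H)$ over all $k$-graphs $H$ on $n$ vertices containing no copy of $F$, and $\pi_\ell(F)=\lim_{n\to\infty}\mathrm{ex}_\ell(n,F)/\binom{n}{k-\ell}$. All logarithms are natural. *)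

(* Defs.v *)
From HB Require Import structures.
From mathcomp Require Import all_boot all_order all_algebra.
From mathcomp Require Import all_classical all_reals all_analysis.

Set Implicit Arguments.
Unset Strict Implicit.
Unset Printing Implicit Defensive.

Import Order.TTheory GRing.Theory Num.Theory.
Import numFieldNormedType.Exports.

Local Open Scope ring_scope.
Local Open Scope classical_set_scope.

(* A hypergraph on the finite vertex type V is given by its set of edges,
   a term of type {set {set V}}. *)

Definition uniform (k : nat) (V : finType) (H : {set {set V}}) : bool :=
  [forall e in H, #|e| == k].

Definition complete_kgraph (k t : nat) : {set {set 'I_t}} :=
  [set e : {set 'I_t} | #|e| == k]%SET.

Definition contains_copy (W V : finType) (F : {set {set W}})
    (H : {set {set V}}) : bool :=
  [exists f : {ffun W -> V}, injectiveb f && [forall e in F, (f @: e)%SET \in H]].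

Definition degree (V : finType) (H : {set {set V}}) (S : {set V}) : nat :=
  #|[set e in H | S \subset e]%SET|.

(* The default value #|H| bounds every degree from above, so it does not affect
   the minimum as soon as V has at least l elements. *)
Definition min_degree (l : nat) (V : finType) (H : {set {set V}}) : nat :=
  \big[minn/#|H|]_(S : {set V} | #|S| == l) degree H S.

Definition ex (k l n : nat) (W : finType) (F : {set {set W}}) : nat :=
  (\max_(H : {set {set 'I_n}} | uniform k H && ~~ contains_copy F H)
      min_degree l H)%N.

Definition turan_density (R : realType) (k l : nat) (W : finType)
    (F : {set {set W}}) : R :=
  lim ((fun n : nat => (ex k l n F)%:R / 'C(n, k - l)%:R : R) @ \oo).

(* Main.v *)
Require Import Defs.
From mathcomp Require Import all_boot all_order all_algebra.
From mathcomp Require Import all_classical all_reals all_analysis.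
From mathcomp Require Import zify ring lra.
From mathcomp Require Import fintype finset.

Import Order.TTheory GRing.Theory Num.Theory.
Import numFieldNormedType.Exports.

Local Open Scope ring_scope.

(** Put p = c0 ln (ln t) / t^(k-1), and suppose that a k-graph H on n vertices
    without a copy of the complete k-graph on t vertices has all its (k-2)-degrees
    above (1 - p) 'C(n, 2). In the k-graph G of its non-edges, every set of k-2
    vertices lies in at most p 'C(n, 2) edges, and no t vertices are independent.
    Hence it suffices to find t independent vertices in every such G on
    sufficiently many vertices; this is [independent_set], and [ex_le] and
    [turan_density_le] translate it into the bound on the density.

    Deleting a vertex from each edge of a random set gives about p^(-1/(k-1))
    independent vertices, so a factor (ln (ln t))^(1/(k-1)) has to be gained. Let mu
    be a small multiple of ln (ln t), let M = 16^(8 3^(k-1) mu) and b = mu M^(k-1),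
    and sample I = 4 M t vertices of G at random. A sampled vertex lies on at most b
    sampled edges on average. Closing a cycle costs a factor b / |I|, because the
    last edge has to contain two prescribed vertices and pairs inherit the degree
    condition of (k-2)-sets (here k >= 4 is used). As b^(O(M)) is smaller than t,
    cycles with O(M) edges are rare. What remains are sunflowers: (k-1)-sets T of
    large codegree, whose edges x |: T overlap in T. By the degree condition two such
    sets rarely share k-2 vertices, so that an edge contains at most one of them, its
    core. Calling two edges equivalent when they have the same core, we obtain
    clusters that are arranged in a tree at distances up to 2 M: after deletion of
    at most half of the sample ([exists_good]), no walk of at most 2 M + 1 edges that
    changes cluster at each step is closed ([good_acyclic]).

    In such a locally tree-like hypergraph of degree at most D = 8 b, give the
    vertices independent uniform labels among M rounds, and accept a vertex unless
    some edge at it is filled by vertices accepted before. A naive analysis fails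
    because acceptance probabilities of neighbours vary with their degrees. So each
    vertex v sends to each cluster Q the message whether v is accepted when Q is
    disregarded, and a message stops accepting once its probability has reached
    1 / M. Messages coming from different branches of the tree are independent, and
    their probabilities are at most 3 / M including ties. A vertex is therefore not
    blocked with probability at least exp (- 2 D (3 / M)^(k-1)), which is
    exp (- 16 3^(k-1) mu) >= 1 / M, so that M rounds suffice to bring messages up to
    the cap, and every vertex is accepted with probability at least 1 / (2 M)
    ([message_passing]). On half of the 4 M t sampled vertices this makes t. *)

Set Implicit Arguments.
Unset Strict Implicit.
Unset Printing Implicit Defensive.

(** * Expectations over uniform random functions *)

Section Expectation.
Variables (R : realFieldType) (I V : finType).
Local Notation Om := {ffun I -> V}.
Implicit Types (A B : {set I}) (w z : Om).

(** Uniform random functions play two roles: random samples of vertices, indexed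
    by I and with repetition, and random labels of vertices by rounds. *)
Definition Ex (f : Om -> R) : R := (\sum_w f w) / #|{: Om}|%:R.

(** Measurability with respect to the coordinates in A. Independence of random
    variables appears as disjointness of such sets (Ex_indep). *)
Definition dep (T : Type) A (f : Om -> T) : Prop :=
  forall w z, {in A, w =1 z} -> f w = f z.

Definition upd w (a : I) (x : V) : Om := [ffun i => if i == a then x else w i].

Definition glue A w z : Om := [ffun i => if i \in A then w i else z i].

Lemma dep_sub (T : Type) A B (f : Om -> T) : A \subset B -> dep A f -> dep B f.
Proof. by move=> /subsetP sAB dA w z wz; apply: dA => i /sAB /wz. Qed.

Lemma dep_upd (T : Type) A (f : Om -> T) w a x :
  dep A f -> a \notin A -> f (upd w a x) = f w.
Proof.
move=> dA aA; apply: dA => i iA; rewrite ffunE; case: eqP => // ia.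
by rewrite -ia iA in aA.
Qed.

Lemma Ex_le f g : (forall w, f w <= g w) -> Ex f <= Ex g.
Proof. by move=> fg; rewrite /Ex ler_wpM2r ?invr_ge0 ?ler0n// ler_sum. Qed.

Lemma eq_Ex f g : f =1 g -> Ex f = Ex g.
Proof. by move=> fg; rewrite /Ex; under eq_bigr do rewrite fg. Qed.

Lemma Ex_ge0 f : (forall w, 0 <= f w) -> 0 <= Ex f.
Proof. by move=> f0; rewrite /Ex mulr_ge0 ?invr_ge0 ?ler0n// sumr_ge0. Qed.

Lemma ExD f g : Ex (fun w => f w + g w) = Ex f + Ex g.
Proof. by rewrite /Ex big_split mulrDl. Qed.

Lemma ExZ c f : Ex (fun w => c * f w) = c * Ex f.
Proof. by rewrite /Ex -mulr_sumr mulrA. Qed.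

Lemma Ex_sum (T : Type) (r : seq T) (P : pred T) (F : T -> Om -> R) :
  Ex (fun w => \sum_(i <- r | P i) F i w) = \sum_(i <- r | P i) Ex (F i).
Proof. by rewrite /Ex exchange_big /= mulr_suml. Qed.

Hypothesis V_gt0 : (0 < #|V|)%N.

Lemma card_Om_gt0 : 0 < #|{: Om}|%:R :> R.
Proof. by rewrite ltr0n card_ffun expn_gt0 V_gt0. Qed.

Lemma Ex_cst c : Ex (fun=> c) = c.
Proof.
rewrite /Ex sumr_const -[c *+ _]mulr_natr mulfK ?gt_eqF ?card_Om_gt0//.
Qed.

Lemma Ex_exists_le f : exists w, f w <= Ex f.
Proof.
apply/existsP; apply: contraT => /existsPn H.
have : Ex f * #|{: Om}|%:R < \sum_w f w.
  rewrite mulr_natr -sumr_const; apply: ltr_sum => [|w _]; last first.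
    by rewrite ltNge.
  have /card_gt0P[w _] : (0 < #|{: Om}|)%N by rewrite card_ffun expn_gt0 V_gt0.
  by apply/hasP; exists w => //; rewrite mem_index_enum.
by rewrite /Ex divfK ?ltxx// gt_eqF ?card_Om_gt0.
Qed.

(** Exchanging a new value at a with the old one is an involution on pairs
    (function, value). The lemma integrates out one fresh coordinate. *)
Lemma Ex_upd a f : Ex f = Ex (fun w => (\sum_x f (upd w a x)) / #|V|%:R).
Proof.
have V0 : #|V|%:R != 0 :> R by rewrite pnatr_eq0 -lt0n.
rewrite /Ex; congr (_ / _); rewrite -mulr_suml; apply: (mulIf V0).
rewrite divfK// pair_big /=.
pose h (u : Om * V) := (upd u.1 a u.2, u.1 a).
have hK : involutive h.
  move=> [w x]; rewrite /h /= ffunE eqxx; congr (_, _).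
  by apply/ffunP => i; rewrite !ffunE; case: eqP => // ->.
rewrite [RHS](reindex_inj (inv_inj hK)) /=.
rewrite (eq_bigr (fun u : Om * V => f u.1)); last first.
  move=> [w x] _ /=; congr f; apply/ffunP => i; rewrite !ffunE.
  by case: eqP => // ->.
rewrite -(pair_big predT predT (fun w _ => f w)) /=.
by under [RHS]eq_bigr do rewrite sumr_const -[_ *+ _]mulr_natr; rewrite mulr_suml.
Qed.

(** Exchanging the coordinates in A between two functions is an involution on
    pairs of functions; it turns the product of f at the first and g at the second
    function into the product of both at the first one. *)
Lemma Ex_indep A B f g : dep A f -> dep B g -> [disjoint A & B] ->
  Ex (fun w => f w * g w) = Ex f * Ex g.
Proof.
move=> dA dB AB; have O0 : #|{: Om}|%:R != 0 :> R by rewrite gt_eqF ?card_Om_gt0.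
rewrite /Ex mulf_div; apply: (mulIf (mulf_neq0 O0 O0)).
rewrite [RHS]divfK ?mulf_neq0// mulrA divfK//.
pose h (u : Om * Om) := (glue A u.1 u.2, glue A u.2 u.1).
have hK : involutive h.
  move=> [w z]; rewrite /h /=; congr (_, _).
    by apply/ffunP => i; rewrite !ffunE; case: (i \in A).
  by apply/ffunP => i; rewrite !ffunE; case: (i \in A).
rewrite mulr_suml mulr_suml.
under [RHS]eq_bigr do rewrite mulr_sumr.
rewrite [RHS]pair_big /=.
under eq_bigr do rewrite mulr_natr -sumr_const.
rewrite pair_big /= [LHS](reindex_inj (inv_inj hK)) /=.
apply: eq_bigr => -[w z] _ /=; congr (_ * _).
  by apply: dA => i iA; rewrite ffunE iA.
apply: dB => i iB; rewrite ffunE; case: ifP => // iA.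
by move/disjointFr: AB => /(_ _ iA); rewrite iB.
Qed.

Lemma dep_prod (J : Type) (r : seq J) (P : pred J) (A : J -> {set I})
    (B : {set I}) (F : J -> Om -> R) :
  (forall j, P j -> dep (A j) (F j)) -> (forall j, P j -> A j \subset B) ->
  dep B (fun w => \prod_(j <- r | P j) F j w).
Proof.
move=> dF sB w z wz; apply: eq_bigr => j Pj.
by apply: dF => // i iA; apply: wz; apply: (subsetP (sB _ Pj)).
Qed.

Lemma Ex_prod (J : finType) (P : pred J) (A : J -> {set I}) (F : J -> Om -> R) :
  (forall j, P j -> dep (A j) (F j)) ->
  (forall j l, P j -> P l -> j != l -> [disjoint A j & A l]) ->
  Ex (fun w => \prod_(j | P j) F j w) = \prod_(j | P j) Ex (F j).
Proof.
move=> dF dA.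
suff H (r : seq J) : uniq r ->
    Ex (fun w => \prod_(j <- r | P j) F j w) = \prod_(j <- r | P j) Ex (F j).
  by apply: H; rewrite index_enum_uniq.
elim: r => [|j r IH] /=.
  by move=> _; rewrite big_nil (eq_Ex (g := fun=> 1)) ?Ex_cst// => w; rewrite big_nil.
move=> /andP[jr ur]; rewrite big_cons; case: ifP => Pj; last first.
  by rewrite -IH//; apply: eq_Ex => w; rewrite big_cons Pj.
rewrite -IH//.
rewrite (eq_Ex (g := fun w => F j w * \prod_(j <- r | P j) F j w)); last first.
  by move=> w; rewrite big_cons Pj.
have rF w : \prod_(j <- r | P j) F j w = \prod_(l <- r | P l && (l != j)) F l w.
  rewrite big_seq_cond [RHS]big_seq_cond; apply: eq_bigl => l.
  by case: eqP => [->|]; rewrite ?(negbTE jr)// andbT.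
apply: (@Ex_indep (A j) (\bigcup_(l | P l && (l != j)) A l)) => //.
- exact: dF.
- move=> w z wz; rewrite !rF.
  have := @dep_prod J r (fun l => P l && (l != j)) A
    (\bigcup_(l | P l && (l != j)) A l) F.
  apply=> // [l /andP[Pl _]|l Pl]; first exact: dF.
  exact: (@bigcup_sup _ _ l).
- apply/bigcup_disjointP => l /andP[Pl lj].
  by apply: dA; rewrite // eq_sym.
Qed.

End Expectation.

(** * Non-backtracking walks and branches *)

Section Walks.
Variables (I : finType) (E : {set {set I}}) (c : {set I} -> {set I}).

(** Walks whose consecutive edges lie in different clusters, the first one
    outside the cluster Q. Edges with a common core share k-1 vertices, so that only
    a change of cluster counts as progress. *)
Fixpoint nbw (Q : {set I}) (v : I) (s : seq ({set I} * I)) : bool :=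
  if s is (e, x) :: s' then
    [&& e \in E, v \in e, x \in e, x != v, c e != Q & nbw (c e) x s']
  else true.

Definition wend (v : I) (s : seq ({set I} * I)) : I := last v (unzip2 s).

(** The branch at v away from the cluster Q. Whether v is accepted when Q is
    disregarded depends on the labels in this set only (dep_accept). *)
Fixpoint reach (i : nat) (v : I) (Q : {set I}) : {set I} :=
  if i is j.+1 then
    v |: \bigcup_(e in E | (v \in e) && (c e != Q))
           \bigcup_(u in e :\ v) reach j u (c e)
  else [set v].

Lemma mem_reach i v Q : v \in reach i v Q.
Proof. by case: i => [|i] /=; rewrite !inE eqxx. Qed.

Lemma reachS i v Q : reach i v Q \subset reach i.+1 v Q.
Proof.
elim: i v Q => [|i IH] v Q.
  by rewrite /= sub1set !inE eqxx.
rewrite [reach i.+1 v Q]/= [reach i.+2 v Q]/=; apply: setUS.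
apply/bigcupsP => e eE; apply: (bigcup_max e) => //.
apply/bigcupsP => u ue; apply: (bigcup_max u) => //; exact: IH.
Qed.

Lemma reach_nbw i v Q x : x \in reach i v Q ->
  exists s, [/\ (size s <= i)%N, nbw Q v s & wend v s = x].
Proof.
elim: i v Q => [|i IH] v Q.
  by rewrite inE => /eqP ->; exists [::].
rewrite [reach _ _ _]/= in_setU1 => /orP[/eqP ->|].
  by exists [::].
case/bigcupP => e /and3P[eE ve cQ] /bigcupP[u]; rewrite !inE => /andP[uv ue].
case/IH => s [ss ns es]; exists ((e, u) :: s); split=> //=.
by rewrite eE ve ue uv cQ.
Qed.

Hypothesis c_neq0 : forall e, e \in E -> c e != set0.

Lemma nbw_set0 Q v s : nbw Q v s -> nbw set0 v s.
Proof.
by case: s => [|[e x] s] //= /and5P[eE -> -> -> /andP[_ ->]]; rewrite c_neq0// eE.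
Qed.

(** The walk s, reversed, can be continued by an edge of the cluster that s avoids
    at its start. Two branches that meet are thereby joined to a closed walk. *)
Lemma nbw_rev s u e y t : nbw (c e) u s -> nbw set0 u ((e, y) :: t) ->
  exists r, [/\ nbw set0 (wend u s) r, size r = (size s + (size t).+1)%N &
               wend (wend u s) r = wend y t].
Proof.
elim: s u e y t => [|[e1 x] s IH] u e y t.
  by move=> _ H; exists ((e, y) :: t).
move=> /and5P[e1E ue1 xe1 xu /andP[ce1 ns]] /and5P[eE ue ye yu /andP[_ nt]].
have [||r [nr sr er]] := IH x e1 u ((e, y) :: t).
- by [].
- by rewrite /= e1E xe1 ue1 eq_sym xu c_neq0//= eE ue ye yu eq_sym ce1.
by exists r; split=> //; rewrite sr /= addSnnS.
Qed.

Variable N : nat.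
Hypothesis acyclic : forall v s, (0 < size s <= N)%N -> nbw set0 v s ->
  wend v s != v.

(** A common point would close a walk that passes from u to u' along e. *)
Lemma reach_disjoint_edge i e u u' : (i.*2 < N)%N -> e \in E ->
  u \in e -> u' \in e -> u != u' ->
  [disjoint reach i u (c e) & reach i u' (c e)].
Proof.
move=> iN eE ue u'e uu'; apply/pred0P => x /=; apply/negP => /andP[].
case/reach_nbw => s [ss ns es] /reach_nbw[s' [ss' ns' es']].
have [|r [nr sr er]] := @nbw_rev s u e u' s' ns.
  by rewrite /= eE ue u'e eq_sym uu' c_neq0.
have := acyclic _ nr; rewrite er es es' eqxx => H; suff: false by []; apply: H.
rewrite sr addnS /=; apply: leq_ltn_trans iN.
by rewrite -addnn leq_add.
Qed.

(** A common point would close a walk that changes at v from the cluster of e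
    to that of e'. *)
Lemma reach_disjoint_vertex i v e e' u u' : (i.*2.+1 < N)%N ->
  e \in E -> e' \in E -> v \in e -> v \in e' -> c e != c e' ->
  u \in e -> u != v -> u' \in e' -> u' != v ->
  [disjoint reach i u (c e) & reach i u' (c e')].
Proof.
move=> iN eE e'E ve ve' cc ue uv u'e u'v; apply/pred0P => x /=; apply/negP => /andP[].
case/reach_nbw => s [ss ns es] /reach_nbw[s' [ss' ns' es']].
have [|r [nr sr er]] := @nbw_rev s u e v ((e', u') :: s') ns.
  by rewrite /= eE ue ve eq_sym uv c_neq0//= e'E ve' u'e u'v eq_sym cc.
have := acyclic _ nr; rewrite er /wend /= -!/(wend _ _) es es' eqxx => H.
suff: false by []; apply: H.
rewrite sr addnS /=; apply: leq_ltn_trans iN.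
by rewrite /= addnS ltnS -addnn leq_add.
Qed.

Lemma notin_reach i v e u : (i.*2 < N)%N -> e \in E -> v \in e -> u \in e ->
  u != v -> v \notin reach i u (c e).
Proof.
move=> iN eE ve ue uv.
have /disjointFl -> // := reach_disjoint_edge iN eE ue ve uv.
exact: mem_reach.
Qed.

End Walks.

(** * Random acceptance by message passing *)

Section MessagePassing.
Variables (R : realType) (I : finType) (E : {set {set I}}).
Variables (c : {set I} -> {set I}) (J k D : nat) (phi psi : R).
Local Notation Om := {ffun I -> 'I_J}.
Local Notation wlt i w v := (nat_of_ord (w v) < i)%N.

(** A vertex with label i counts as ready in round i, whether it is accepted or
    not. So an edge with several vertices of the largest label blocks all of them, and
    ties need no further rule. *)
Definition ready (A : I -> {set I} -> Om -> bool) (i : nat) u Q (w : Om) : bool :=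
  (w u == i :> nat) || A u Q w.

Definition blocked A i v Q (w : Om) : bool :=
  [exists e, [&& e \in E, v \in e, c e == Q & [forall u in e :\ v, ready A i u Q w]]].

Definition pass A i v (P : pred {set I}) (w : Om) : bool :=
  [forall Q, P Q ==> ~~ blocked A i v Q w].

(** The message of v to the cluster Q about the labels below i. The test
    against phi keeps all messages below phi + 1 / J (accept_prob_le) whatever the
    degrees are; on a regular tree all messages would have the same probability, and
    no such cap would be required. *)
Fixpoint accept (i : nat) (v : I) (Q : {set I}) (w : Om) : bool :=
  if i is j.+1 then
    accept j v Q w || [&& w v == j :> nat, Ex (fun z => (accept j v Q z)%:R) < phi &
                       pass (accept j) j v (predC1 Q) w]
  else false.

Definition accept_prob i v Q : R := Ex (fun w => (accept i v Q w)%:R).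

(** All caps are tested, so that an accepted vertex is accepted in each of its
    messages (final_accept). *)
Definition final v (w : Om) : bool :=
  [forall Q, accept_prob (w v) v Q < phi] && pass (accept (w v)) (w v) v predT w.

Lemma accept_lt i v Q w : accept i v Q w -> wlt i w v.
Proof.
elim: i => //= i IH /orP[/IH/ltnW//|/and3P[/eqP -> _ _]]; exact: ltnSn.
Qed.

Lemma accept_mono i j v Q w : (i <= j)%N -> accept i v Q w -> accept j v Q w.
Proof.
by move=> /subnK <-; elim: (j - i)%N => //= n IH /IH ->.
Qed.

Lemma final_accept v Q w : final v w -> accept (w v).+1 v Q w.
Proof.
move=> /andP[/forallP/(_ Q) pQ pa] /=; rewrite eqxx -/(accept_prob _ _ _) pQ /=.
apply/orP; right; apply/forallP => Q'; apply/implyP => _.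
by move/forallP: pa => /(_ Q').
Qed.

(** In an edge of accepted vertices, a vertex of largest label would be blocked
    by the others. *)
Lemma final_independent (e : {set I}) w : e \in E -> e != set0 ->
  ~~ [forall u in e, final u w].
Proof.
move=> eE /set0Pn[x xe]; apply/negP => /forall_inP fe.
have [v ve vmax] : exists2 v, v \in e & forall u, u \in e -> (w u <= w v)%N.
  by case: (arg_maxnP (fun u => nat_of_ord (w u)) xe) => v ve vm; exists v.
have /andP[_ /forallP/(_ (c e))/=/negP] := fe v ve; apply.
apply/existsP; exists e; rewrite eE ve eqxx /=.
apply/forall_inP => u; rewrite !inE => /andP[_ ue]; rewrite /ready.
have := vmax u ue; rewrite leq_eqVlt => /orP[->//|uv].
by rewrite (accept_mono uv) ?orbT// final_accept// fe.
Qed.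

Hypothesis J_gt0 : (0 < J)%N.
Hypothesis E_card : forall e, e \in E -> #|e| = k.
Hypothesis c_sub : forall e, e \in E -> c e \subset e.
Hypothesis c_card : forall e, e \in E -> (1 < #|c e|)%N.
Hypothesis acyclic : forall v s, (0 < size s <= J.*2)%N -> nbw E c set0 v s ->
  wend v s != v.
Hypothesis deg_le : forall v, (#|[set e in E | v \in e]| <= D)%N.
Hypothesis phi_gt0 : 0 < phi.
Hypothesis psi_ge : phi + 2 * J%:R^-1 <= psi.
Hypothesis psi_le : psi <= 2^-1.
Hypothesis phi_le : phi <= expR (- (2 * (D%:R * psi ^+ k.-1))).

Let c_neq0 e : e \in E -> c e != set0.
Proof. by move=> eE; rewrite -card_gt0 ltnW// c_card. Qed.

Let O_gt0 : (0 < #|{: 'I_J}|)%N. Proof. by rewrite card_ord. Qed.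

Local Notation reach := (reach E c).

Let blockedD i v Q : {set I} :=
  \bigcup_(e in E | (v \in e) && (c e == Q)) \bigcup_(u in e :\ v) reach i u Q.

Lemma dep_ready i u Q : dep (reach i u Q) (accept i u Q) ->
  dep (reach i u Q) (ready (accept i) i u Q).
Proof.
move=> dA w z wz; rewrite /ready (dA _ _ wz) wz//; exact: mem_reach.
Qed.

Lemma dep_blocked i v Q : (forall u, dep (reach i u Q) (accept i u Q)) ->
  dep (blockedD i v Q) (blocked (accept i) i v Q).
Proof.
move=> dA w z wz; apply: eq_existsb => e.
case eE: (e \in E) => //=; case ve: (v \in e) => //=.
case: eqP => //= cQ; apply: eq_forallb_in => u ue.
apply: (dep_ready (dA u)) => x xr; apply: wz.
apply/bigcupP; exists e; first by rewrite eE ve cQ eqxx.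
by apply/bigcupP; exists u.
Qed.

Lemma dep_accept i v Q : dep (reach i v Q) (accept i v Q).
Proof.
elim: i v Q => [|i IH] v Q; first by move=> w z _.
move=> w z wz; rewrite [LHS]/= [RHS]/=.
have -> : accept i v Q w = accept i v Q z.
  by apply: IH => x xr; apply: wz; apply: (subsetP (reachS _ _ _ _ _)).
have -> : w v = z v by apply: wz; exact: mem_reach.
congr (_ || [&& _, _ & _]); apply: eq_forallb => Q'.
case QQ: (predC1 Q Q') => //=; congr (~~ _).
apply: (dep_blocked (fun u => IH u Q')) => x /bigcupP[e /and3P[eE ve /eqP cQ]] xe.
apply: wz; rewrite [reach _ _ _]/= in_setU1; apply/orP; right.
apply/bigcupP; exists e; last by rewrite cQ.
by rewrite eE ve cQ.
Qed.

Lemma Ex_label v (i : nat) : (i < J)%N ->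
  Ex (fun w : Om => (w v == i :> nat)%:R) = J%:R^-1 :> R.
Proof.
move=> iJ; rewrite (Ex_upd O_gt0 v) (eq_Ex (g := fun=> J%:R^-1)) ?Ex_cst//.
move=> w; under eq_bigr do rewrite ffunE eqxx.
rewrite (bigD1 (Ordinal iJ))//= eqxx big1 ?addr0 ?card_ord ?mul1r//.
by move=> x; rewrite -val_eqE /= => /negbTE ->.
Qed.

Let Jinv_ge0 : 0 <= J%:R^-1 :> R.
Proof. by rewrite invr_ge0 ler0n. Qed.

Lemma Ex_label_le v (i : nat) :
  Ex (fun w : Om => (w v == i :> nat)%:R) <= J%:R^-1 :> R.
Proof.
case: (ltnP i J) => [iJ|Ji]; first by rewrite Ex_label.
rewrite (eq_Ex (g := fun=> 0)) ?Ex_cst// => w.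
by rewrite ltn_eqF// (leq_trans (ltn_ord _) Ji).
Qed.

Lemma accept_prob_ge0 i v Q : 0 <= accept_prob i v Q.
Proof. by apply: Ex_ge0 => w; rewrite ler0n. Qed.

Lemma accept_prob_le i v Q : accept_prob i v Q <= phi + J%:R^-1.
Proof.
elim: i => [|i IH].
  rewrite /accept_prob /= (eq_Ex (g := fun=> 0)) ?Ex_cst ?addr_ge0// ?ltW//.
case: (ltP (accept_prob i v Q) phi) => h.
  apply: le_trans (_ : accept_prob i v Q + J%:R^-1 <= _); last by rewrite lerD2r ltW.
  apply: le_trans (_ : _ <= accept_prob i v Q + Ex (fun w : Om => (w v == i :> nat)%:R)) _;
    last by rewrite lerD2l Ex_label_le.
  rewrite /accept_prob -ExD; apply: Ex_le => w /=.
  rewrite -natrD ler_nat; case: (accept i v Q w) => /=; first by rewrite leq_addr.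
  by case: (_ == _) => //=; rewrite leq_b1.
apply: le_trans IH; rewrite le_eqVlt; apply/orP; left; apply/eqP.
by apply: eq_Ex => w /=; rewrite -/(accept_prob _ _ _) ltNge h andbF orbF.
Qed.

Lemma Ex_ready_le i u Q : Ex (fun w => (ready (accept i) i u Q w)%:R) <= psi.
Proof.
apply: le_trans psi_ge; rewrite mulr2n mulrDl mul1r addrA.
apply: le_trans (_ : _ <= Ex (fun w : Om => (w u == i :> nat)%:R) + accept_prob i u Q) _;
  last by rewrite addrC lerD ?accept_prob_le ?Ex_label_le.
rewrite -ExD; apply: Ex_le => w /=; rewrite /ready -natrD ler_nat.
by case: (_ == _); case: accept.
Qed.

Let psi_ge0 : 0 <= psi.
Proof.
by apply: le_trans psi_ge; apply: addr_ge0; [exact: ltW|exact: mulr_ge0].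
Qed.

Definition cluster_degree v Q := #|[set e in E | (v \in e) && (c e == Q)]|.

(** The messages that reach v through one edge come from disjoint branches. *)
Lemma Ex_blocked_le_deg i v Q : (i < J)%N ->
  Ex (fun w => (blocked (accept i) i v Q w)%:R) <= (cluster_degree v Q)%:R * psi ^+ k.-1.
Proof.
move=> iJ; pose P := [set e in E | (v \in e) && (c e == Q)].
apply: le_trans (_ : _ <= Ex (fun w => \sum_(e in P)
    \prod_(u in e :\ v) (ready (accept i) i u Q w)%:R)) _.
  apply: Ex_le => w.
  have [/existsP[e /and4P[eE ve cQ /forall_inP fe]]|_] := boolP (blocked _ _ _ _ _).
    rewrite (bigD1 e) /=; last by rewrite inE eE ve.
    rewrite big1 ?ler_wpDr ?sumr_ge0//; last by move=> u /fe ->.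
    by move=> e' _; rewrite prodr_ge0// => u _; rewrite ler0n.
  by apply: sumr_ge0 => e _; apply: prodr_ge0 => u _; rewrite ler0n.
rewrite Ex_sum /cluster_degree mulr_natl -sumr_const; apply: ler_sum => e.
rewrite inE => /and3P[eE ve /eqP cQ].
have iJ2 : (i.*2 < J.*2)%N by rewrite ltn_double.
rewrite (Ex_prod O_gt0 (A := fun u => reach i u Q)); first last.
- move=> u u'; rewrite !inE => /andP[uv ue] /andP[u'v u'e] uu'.
  by rewrite -cQ; apply: (reach_disjoint_edge c_neq0 acyclic).
- by move=> u _ w z wz; rewrite (dep_ready (@dep_accept i u Q) wz).
have <- : #|e :\ v| = k.-1 by rewrite -(E_card eE) (cardsD1 v e) ve.
rewrite -prodr_const; apply: ler_prod => u _.
by rewrite Ex_ready_le andbT; apply: Ex_ge0 => w; rewrite ler0n.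
Qed.

(** All the edges of the cluster Q at v contain one and the same vertex of Q
    other than v, and that vertex is rarely ready. *)
Lemma Ex_blocked_le_half i v Q :
  Ex (fun w => (blocked (accept i) i v Q w)%:R) <= 2^-1 :> R.
Proof.
have [/existsP[e /and3P[eE ve /eqP cQ]]|/existsPn H] :=
    boolP [exists e, [&& e \in E, v \in e & c e == Q]]; last first.
  rewrite (eq_Ex (g := fun=> 0)) ?Ex_cst// => w.
  case: (boolP (blocked _ _ _ _ _)) => //= /existsP[e /and4P[eE ve cQ _]].
  by have := H e; rewrite eE ve cQ.
have [u uQ uv] : exists2 u, u \in Q & u != v.
  have : (0 < #|Q :\ v|)%N.
    have := c_card eE; rewrite cQ (cardsD1 v Q); case: (v \in Q) => //=.
    by rewrite add0n => /ltnW.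
  by case/card_gt0P => u; rewrite !inE => /andP[uv uQ]; exists u.
apply: le_trans psi_le; apply: le_trans (Ex_ready_le i u Q); apply: Ex_le => w.
rewrite ler_nat; case: (boolP (blocked _ _ _ _ _)) => //=.
move=> /existsP[f /and4P[fE vf /eqP fQ /forall_inP/(_ u)]].
by rewrite !inE uv (subsetP (c_sub fE)) ?fQ// => ->.
Qed.

Lemma one_sub_ge_expR (x : R) : 0 <= x <= 2^-1 -> expR (- (2 * x)) <= 1 - x.
Proof.
move=> /andP[x0 x1]; rewrite expRN.
have h : 0 < 1 + 2 * x by rewrite ltr_pwDl// mulr_ge0.
apply: le_trans (_ : (1 + 2 * x)^-1 <= _).
  by rewrite lef_pV2 ?posrE ?expR_gt0// expR_ge1Dx.
rewrite -[leLHS]mul1r ler_pdivrMr//.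
have : 0 <= x * (1 - 2 * x).
  rewrite mulr_ge0// subr_ge0 mulrC; move: x1; lra.
lra.
Qed.

Definition pass_prob i v P : R := Ex (fun w => (pass (accept i) i v P w)%:R).

Lemma passE i v P w : (pass (accept i) i v P w)%:R =
  \prod_(Q | P Q) (1 - (blocked (accept i) i v Q w)%:R) :> R.
Proof.
rewrite /pass; case: forallP => [H|/forallP/forallPn[Q]].
  rewrite big1// => Q PQ; have := H Q; rewrite PQ /= => /negbTE ->.
  by rewrite subr0.
rewrite negb_imply negbK => /andP[PQ bQ].
by rewrite (bigD1 Q)//= bQ subrr mul0r.
Qed.

Lemma disjoint_blockedD i v Q Q' : (i < J)%N -> Q != Q' ->
  [disjoint blockedD i v Q & blockedD i v Q'].
Proof.
move=> iJ QQ; apply/bigcup_disjointP => e' /and3P[e'E ve' /eqP cQ'].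
apply/bigcup_disjointP => u' /[!inE] /andP[u'v u'e'].
rewrite disjoint_sym; apply/bigcup_disjointP => e /and3P[eE ve /eqP cQ].
apply/bigcup_disjointP => u /[!inE] /andP[uv ue].
rewrite disjoint_sym -cQ -cQ'.
apply: (reach_disjoint_vertex c_neq0 acyclic (v := v)) => //; last by rewrite cQ cQ'.
by move: iJ; clear; lia.
Qed.

Lemma notin_blockedD i v Q : (i < J)%N -> v \notin blockedD i v Q.
Proof.
move=> iJ; apply/bigcupP => -[e /and3P[eE ve /eqP cQ]] /bigcupP[u].
rewrite !inE => /andP[uv ue]; rewrite -cQ; apply/negP.
by apply: (notin_reach c_neq0 acyclic); rewrite ?ltn_double.
Qed.

Lemma dep_passf i v Q :
  dep (blockedD i v Q) (fun w => 1 - (blocked (accept i) i v Q w)%:R : R).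
Proof.
by move=> w z wz; rewrite (dep_blocked (fun u => @dep_accept i u Q) wz).
Qed.

(** Different clusters at v lie on disjoint branches, so they block independently. *)
Lemma pass_probE i v P : (i < J)%N ->
  pass_prob i v P = \prod_(Q | P Q) (1 - Ex (fun w => (blocked (accept i) i v Q w)%:R)).
Proof.
move=> iJ; rewrite /pass_prob (eq_Ex (passE i v P)).
rewrite (Ex_prod O_gt0 (A := fun Q => blockedD i v Q)); first last.
- by move=> Q Q' _ _; apply: disjoint_blockedD.
- by move=> Q _; apply: dep_passf.
apply: eq_bigr => Q _.
rewrite (eq_Ex (g := fun w => 1 + (-1) * (blocked (accept i) i v Q w)%:R)).
  by rewrite ExD ExZ Ex_cst// mulN1r.
by move=> w; rewrite mulN1r.
Qed.

(** As every factor is at least 1/2, the inequality 1 - x >= exp (- 2 x) turns the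
    product over clusters into a sum over the edges at v. *)
Lemma pass_prob_ge i v P : (i < J)%N -> phi <= pass_prob i v P.
Proof.
move=> iJ; apply: le_trans phi_le _; rewrite pass_probE//.
have Ek0 : 0 <= psi ^+ k.-1 by rewrite exprn_ge0.
apply: le_trans (_ : expR (\sum_(Q | P Q) - (2 * ((cluster_degree v Q)%:R * psi ^+ k.-1))) <= _).
  rewrite ler_expR sumrN lerN2 -mulr_sumr ler_wpM2l// -mulr_suml.
  rewrite ler_wpM2r// -natr_sum ler_nat.
  apply: leq_trans (deg_le v).
  have -> : #|[set e in E | v \in e]| = (\sum_Q cluster_degree v Q)%N.
    rewrite -sum1_card (partition_big c predT)//=; apply: eq_bigr => Q _.
    by rewrite /cluster_degree -sum1_card; apply: eq_bigl => e; rewrite !inE andbA.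
  by rewrite big_mkcond; apply: leq_sum => Q _; case: ifP.
rewrite expR_sum; apply: ler_prod => Q _; rewrite expR_ge0/=.
set x := Ex _; set y := _ * psi ^+ _.
have xy : x <= y by apply: Ex_blocked_le_deg.
apply: le_trans (_ : expR (- (2 * x)) <= _).
  by rewrite ler_expR lerN2 ler_wpM2l.
apply: one_sub_ge_expR; rewrite Ex_blocked_le_half andbT.
by apply: Ex_ge0 => w; rewrite ler0n.
Qed.

Lemma dep_pass i v P :
  dep (\bigcup_Q blockedD i v Q) (fun w => (pass (accept i) i v P w)%:R : R).
Proof.
move=> w z wz; rewrite !passE; apply: eq_bigr => Q _.
by apply: dep_passf => x xQ; apply: wz; apply/bigcupP; exists Q.
Qed.

Lemma Ex_label_pass i v P : (i < J)%N ->
  Ex (fun w : Om => (w v == i :> nat)%:R * (pass (accept i) i v P w)%:R) =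
  J%:R^-1 * pass_prob i v P.
Proof.
move=> iJ; rewrite -(Ex_label v iJ).
apply: (Ex_indep O_gt0 (A := [set v]) (B := \bigcup_Q blockedD i v Q)).
- by move=> w z wz; rewrite wz// inE.
- exact: dep_pass.
- rewrite disjoints1; apply/bigcupP => -[Q _]; apply/negP; exact: notin_blockedD.
Qed.

Lemma accept_probS i v Q : (i < J)%N -> accept_prob i v Q < phi ->
  accept_prob i.+1 v Q = accept_prob i v Q + J%:R^-1 * pass_prob i v (predC1 Q).
Proof.
move=> iJ h; rewrite -Ex_label_pass// -ExD; apply: eq_Ex => w.
rewrite [accept i.+1 v Q w]/= -/(accept_prob i v Q) h /= -natrM -natrD mulnb.
have [/accept_lt a|] := boolP (accept i v Q w); last by rewrite add0n.
by rewrite ltn_eqF.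
Qed.

Lemma pass_prob_half i v Q : (i < J)%N ->
  2^-1 * pass_prob i v (predC1 Q) <= pass_prob i v predT.
Proof.
move=> iJ; rewrite !pass_probE// [leRHS](bigD1 Q)//=.
set x := Ex _; have x2 : x <= 2^-1 by exact: Ex_blocked_le_half.
apply: ler_wpM2r; last by move: x2; lra.
apply: prodr_ge0 => Q' _; rewrite subr_ge0.
by apply: le_trans (Ex_blocked_le_half _ _ _) _; rewrite invf_le1 ?ler1n.
Qed.

(** Below the cap each round contributes at least phi / J to a message, so some
    message of v reaches the cap within J rounds. Until this happens for the first
    time, no cap at v is active, and the probability of final acceptance gains in
    each round at least half of what that message gains. *)
Lemma Ex_final_ge v : phi / 2 <= Ex (fun w => (final v w)%:R).
Proof.
pose full i := [exists Q, phi <= accept_prob i v Q].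
have JV : J%:R * J%:R^-1 = 1 :> R by rewrite mulfV// pnatr_eq0 -lt0n.
have not_full i Q : ~~ full i -> accept_prob i v Q < phi.
  by move/existsPn/(_ Q); rewrite -ltNge.
(* Otherwise every round would add at least phi / J to the message to set0. *)
have [l fl] : exists i : 'I_J.+1, full i.
  apply/existsP; apply: contraT => /existsPn H.
  have grow i : (i <= J)%N -> i%:R * (J%:R^-1 * phi) <= accept_prob i v set0.
    elim: i => [_|i IH iJ]; first by rewrite mul0r accept_prob_ge0.
    have iJ' : (i < J.+1)%N by rewrite ltnS ltnW.
    rewrite accept_probS//; last by apply: not_full; exact: (H (Ordinal iJ')).
    rewrite -natr1 mulrDl mul1r lerD ?IH 1?ltnW// ler_wpM2l//.
    exact: pass_prob_ge.
  have /existsPn/(_ set0) := H ord_max.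
  by rewrite -ltNge ltNge; have := grow J (leqnn J); rewrite mulrA JV mul1r => ->.
have [m fm mmin] := ex_minnP (ex_intro _ (nat_of_ord l) fl).
have mJ : (m <= J)%N by apply: leq_trans (mmin _ fl) _; rewrite -ltnS.
have lt_m i Q : (i < m)%N -> accept_prob i v Q < phi.
  by move=> im; apply: not_full; apply: contraTN im => /mmin; rewrite -leqNgt.
have [Q phiQ] := existsP fm.
have half j : (j <= m)%N ->
    2^-1 * accept_prob j v Q <= \sum_(i < j) J%:R^-1 * pass_prob i v predT.
  elim: j => [_|j IH jm].
    by rewrite big_ord0 /accept_prob (eq_Ex (g := fun=> 0)) ?Ex_cst ?mulr0.
  have jJ : (j < J)%N := leq_trans jm mJ.
  rewrite big_ord_recr/= accept_probS ?lt_m// mulrDr lerD ?IH 1?ltnW// mulrCA.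
  by rewrite ler_wpM2l// pass_prob_half.
apply: le_trans (_ : _ <= 2^-1 * accept_prob m v Q) _.
  by rewrite mulrC ler_wpM2l// invr_ge0.
apply: le_trans (half m (leqnn m)) _.
under eq_bigr => i _ do rewrite -(Ex_label_pass _ _ (leq_trans (ltn_ord i) mJ)).
rewrite -Ex_sum; apply: Ex_le => w.
case: (ltnP (w v) m) => wm; last first.
  rewrite big1 ?ler0n// => i _; rewrite gtn_eqF ?mul0r//.
  exact: leq_trans (ltn_ord i) wm.
rewrite (bigD1 (Ordinal wm))//= eqxx mul1r big1 ?addr0; last first.
  by move=> i; rewrite -val_eqE /= eq_sym => /negbTE ->; rewrite mul0r.
rewrite ler_nat /final; suff -> : [forall Q0, accept_prob (w v) v Q0 < phi] by [].
by apply/forallP => Q'; exact: lt_m.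
Qed.

(** The quantity D psi^(k-1) bounds the expected number of edges that block a
    vertex, and exp (- 2 D psi^(k-1)) the probability not to be blocked. *)
Lemma message_passing (U : {set I}) : exists2 W : {set I}, W \subset U &
  [forall e in E, ~~ (e \subset W)] /\ #|U|%:R * (phi / 2) <= #|W|%:R.
Proof.
pose W w := [set v in U | final v w].
have [w Hw] := Ex_exists_le O_gt0 (fun w => - (#|W w|%:R : R)).
exists (W w); first by apply/subsetP => v; rewrite inE => /andP[].
split.
  apply/forall_inP => e eE; apply/negP => /subsetP eW.
  have e0 : e != set0.
    apply: contraTneq (c_card eE) => e0; have := c_sub eE.
    by rewrite e0 subset0 => /eqP ->; rewrite cards0.
  have /forall_inP[] := final_independent w eE e0.
  by move=> u /eW; rewrite inE => /andP[].
move: Hw; rewrite (eq_Ex (g := fun w => (-1) * #|W w|%:R)); last by move=> z; rewrite mulN1r.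
rewrite ExZ mulN1r lerN2; apply: le_trans.
rewrite mulr_natl -sumr_const.
rewrite (eq_Ex (g := fun w => \sum_(v in U) (final v w)%:R)).
  by rewrite Ex_sum; apply: ler_sum => v _; exact: Ex_final_ge.
move=> z; rewrite -sum1_card natr_sum big_mkcond [RHS]big_mkcond /=.
by apply: eq_bigr => v _; rewrite inE; case: (v \in U) => //=; case: (final v z).
Qed.

End MessagePassing.

(** * Fresh walks and cycle counts *)

Section Cycles.
Variables (R : realType) (I : finType) (k : nat).

(** The number of ways to leave v by l edges, each of which meets X and its
    predecessors in the current vertex only, and to return to y by one more edge. The
    recursion follows the walk so that expectations can be taken edge by edge
    (Ex_cycle_count_le). *)
Fixpoint cycle_count (E : {set {set I}}) (l : nat) (y : I) (X : {set I}) (v : I) : R :=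
  if l is j.+1 then
    \sum_(e : {set I} | (#|e| == k) && (e :&: X == [set v]))
      \sum_(u in e :\ v) (e \in E)%:R * cycle_count E j y (X :|: e) u
  else \sum_(e : {set I} | (#|e| == k) && (e :&: X == [set v; y])) (e \in E)%:R.

Lemma cycle_count_ge0 E l y X v : 0 <= cycle_count E l y X v.
Proof.
elim: l X v => [|l IH] X v /=; first by apply: sumr_ge0 => e _; rewrite ler0n.
by apply: sumr_ge0 => e _; apply: sumr_ge0 => u _; rewrite mulr_ge0.
Qed.

End Cycles.

Section FreshWalks.
Variables (R : realType) (I : finType) (E : {set {set I}}) (c : {set I} -> {set I}).

Fixpoint covered (s : seq ({set I} * I)) : {set I} :=
  if s is (e, _) :: s' then e :|: covered s' else finset.set0.

Fixpoint fresh (X : {set I}) (v : I) (s : seq ({set I} * I)) : bool :=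
  if s is (e, x) :: s' then (e :&: X == [set v]) && fresh (X :|: e) x s' else true.

Lemma wend_rcons (v : I) s z : wend v (rcons s z) = z.2.
Proof. by rewrite /wend /unzip2 map_rcons last_rcons. Qed.

Lemma fresh_rcons X v s e x : fresh X v (rcons s (e, x)) =
  fresh X v s && (e :&: (X :|: covered s) == [set wend v s]).
Proof.
elim: s X v => [|[f y] s IH] X v /=; first by rewrite setU0 andbT.
by rewrite IH setUA andbA.
Qed.

Lemma nbw_rcons Q v s e x : nbw E c Q v (rcons s (e, x)) ->
  nbw E c Q v s /\ [&& e \in E, wend v s \in e, x \in e & x != wend v s].
Proof.
elim: s Q v => [|[f y] s IH] Q v /=; first by move=> /and5P[-> -> -> -> _].
by move=> /and5P[-> -> -> -> /andP[-> /IH]].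
Qed.

Lemma fresh_wend Q X v s : nbw E c Q v s -> fresh X v s -> s != [::] ->
  wend v s \notin X.
Proof.
elim: s Q X v => [//|[e x] s IH] Q X v /= /and5P[eE ve xe xv /andP[_ ns]].
move=> /andP[/eqP eX fs] _; have [s0|s0] := eqVneq s [::].
  rewrite s0 /wend /=; apply: contra xv => xX.
  by have : x \in e :&: X by [rewrite inE xe]; rewrite eX inE.
by have := IH _ _ _ ns fs s0; rewrite inE negb_or => /andP[].
Qed.

Lemma fresh_add X v s z : z \notin covered s -> fresh X v s -> fresh (z |: X) v s.
Proof.
elim: s X v => [//|[e x] s IH] X v /=; rewrite inE negb_or => /andP[ze zs].
move=> /andP[/eqP eX fs]; rewrite -setUA IH// andbT setIUr eX.
apply/eqP/setP => t; rewrite !inE; case: (t =P z) => [->|_].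
  by rewrite (negbTE ze).
by rewrite andbF.
Qed.

Lemma cycle_count_ge1 (F : {set {set I}}) k Q (X e : {set I}) v s y :
  E \subset F -> (forall f, f \in F -> #|f| = k) ->
  nbw E c Q v s -> fresh X v s -> e \in F ->
  e :&: (X :|: covered s) = [set wend v s; y] ->
  1 <= cycle_count R k F (size s) y X v.
Proof.
move=> EF Fk; elim: s Q X v => [|[f x] s IH] Q X v.
  move=> _ _ eF; rewrite /= setU0 => eX.
  rewrite (bigD1 e) /=; last by rewrite Fk// eX !eqxx.
  by rewrite eF ler_wpDr// sumr_ge0.
move=> /and5P[fE vf xf xv /andP[_ ns]] /andP[fX fs] eF eX.
have fF := subsetP EF _ fE.
rewrite [cycle_count _ _ _ _ _ _ _]/= (bigD1 f) /=; last by rewrite Fk// eqxx.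
rewrite (bigD1 x) /=; last by rewrite !inE xv xf.
rewrite fF mul1r -addrA ler_wpDr//.
  apply: addr_ge0; apply: sumr_ge0 => g _; first by apply: mulr_ge0 => //; exact: cycle_count_ge0.
  by apply: sumr_ge0 => u _; apply: mulr_ge0 => //; exact: cycle_count_ge0.
apply: IH ns fs eF _.
by rewrite -setUA.
Qed.

End FreshWalks.

(** * Random samples of a hypergraph with bounded (k-2)-degrees *)

Lemma bin_le_expn n m : ('C(n, m) <= n ^ m)%N.
Proof.
elim: m n => [|m IH] n; first by rewrite bin0.
apply: leq_trans (_ : m.+1 * 'C(n, m.+1) <= _)%N; first by rewrite leq_pmull.
rewrite -mul_bin_diag expnS leq_mul2l; apply/orP; right.
by apply: leq_trans (IH n); rewrite leq_bin2l// leq_pred.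
Qed.

Lemma card_supersets (I : finType) (A : {set I}) (m : nat) :
  (#|[set e : {set I} | (#|e| == m) && (A \subset e)]| <= #|I| ^ (m - #|A|))%N.
Proof.
set S := [set e | _].
have injD : {in S &, injective (fun e => e :\: A)}.
  move=> e f; rewrite !inE => /andP[_ /setIidPr Ae] /andP[_ /setIidPr Af] ef.
  by rewrite -(setID e A) -(setID f A) ef Ae Af.
rewrite -(card_in_imset injD); apply: leq_trans (bin_le_expn _ _).
rewrite -card_draws; apply/subset_leq_card/subsetP => C /imsetP[e].
rewrite !inE => /andP[/eqP em /setIidPr Ae] ->.
by rewrite cardsD Ae em.
Qed.

Section Sampling.
Variables (R : realType) (V I : finType) (G : {set {set V}}) (k : nat) (p : R).
Local Notation Om := {ffun I -> V}.
Local Notation n := (#|V|%:R : R).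
Local Notation s := (#|I|%:R : R).

(** Since the edges of G have k elements, the condition on #|e| makes w injective
    on e. *)
Definition pullback (w : Om) : {set {set I}} :=
  [set e : {set I} | (#|e| == k) && (w @: e \in G)].

Definition codeg (S : {set V}) : R := (\sum_y (y |: S \in G)%:R) / n.

Definition high (t : R) (w : Om) (T : {set I}) : bool := t <= codeg (w @: T).

Hypothesis V_gt0 : (0 < #|V|)%N.
Hypothesis k_ge4 : (4 <= k)%N.
Hypothesis G_card : forall e, e \in G -> #|e| = k.
Hypothesis p_ge0 : 0 <= p.
Hypothesis G_deg : forall C : {set V}, #|C| = (k - 2)%N ->
  \sum_x \sum_y (y |: (x |: C) \in G)%:R <= p * n ^+ 2.

Let n_gt0 : 0 < n. Proof. by rewrite ltr0n. Qed.

Lemma G_deg_le (C : {set V}) : (#|C| <= k - 2)%N ->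
  (\sum_x (\sum_y (y |: (x |: C) \in G)%:R) / n) / n <= p.
Proof.
rewrite leq_eqVlt => /orP[/eqP/G_deg h|Ck].
  by rewrite -mulr_suml -mulrA -invfM ler_pdivrMr// mulr_gt0.
rewrite big1 ?mul0r// => x _; rewrite big1 ?mul0r// => y _.
case: (boolP (_ \in G)) => //= /G_card; rewrite !cardsU1 => h.
exfalso; move: h Ck; move: k_ge4; case: (_ \notin _); case: (_ \notin _); clear; lia.
Qed.

Lemma codeg_ge0 S : 0 <= codeg S.
Proof. by rewrite /codeg mulr_ge0 ?invr_ge0 ?sumr_ge0. Qed.

Lemma imset_upd (w : Om) a x (C : {set I}) : a \notin C ->
  upd w a x @: (a |: C) = x |: w @: C.
Proof.
move=> aC; rewrite imsetU1 ffunE eqxx; congr (_ |: _).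
by apply: eq_in_imset => i iC; rewrite ffunE; case: eqP => // ia; rewrite -ia iC in aC.
Qed.

Lemma Ex_upd_le X (f g h : Om -> R) a : dep X f -> a \notin X ->
  (forall w, 0 <= f w) -> (forall w, (\sum_x g (upd w a x)) / n <= h w) ->
  Ex (fun w => f w * g w) <= Ex (fun w => f w * h w).
Proof.
move=> dX aX f0 gh; rewrite (Ex_upd V_gt0 a); apply: Ex_le => w.
under eq_bigr do rewrite (dep_upd _ _ dX aX).
by rewrite -mulr_sumr -mulrA ler_wpM2l.
Qed.

Lemma ExZr c (f : Om -> R) : Ex (fun w => f w * c) = c * Ex f.
Proof. by rewrite -ExZ; apply: eq_Ex => w; rewrite mulrC. Qed.

(** Two vertices of e lie outside X. Given all other values of w, the degree
    condition on G bounds the probability that these two complete an edge. *)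
Lemma Ex_edge_le X (f : Om -> R) (e : {set I}) : dep X f ->
  (forall w, 0 <= f w) -> #|e| = k -> (#|e :&: X| <= k - 2)%N ->
  Ex (fun w => f w * (e \in pullback w)%:R) <= p * Ex f.
Proof.
move=> dX f0 ek eX.
have /card_gt1P[a [b []]] : (1 < #|e :\: X|)%N.
  by have := cardsID X e; move: ek eX k_ge4; clear; lia.
rewrite !inE => /andP[aX ae] /andP[bX be] ab.
pose C := e :\ a :\ b.
have aC : a \notin b |: C by rewrite !inE eqxx (negbTE ab).
have bC : b \notin C by rewrite !inE eqxx.
have eE : e = a |: (b |: C) by rewrite /C setD1K ?setD1K// !inE eq_sym ab.
pose g (w : Om) : R := (\sum_x (x |: (w @: (b |: C)) \in G)%:R) / n.
apply: le_trans (_ : _ <= Ex (fun w => f w * g w)) _.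
  apply: (Ex_upd_le dX aX) => // w; rewrite /g ler_wpM2r ?invr_ge0//.
  apply: ler_sum => x _; rewrite inE ek eqxx /= eE.
  by rewrite imset_upd.
rewrite -ExZr; apply: (Ex_upd_le dX bX) => // w; rewrite /g.
under eq_bigr do rewrite imset_upd//.
apply: G_deg_le; apply: leq_trans (leq_imset_card _ _) _.
by move: ek k_ge4; rewrite eE !cardsU1 aC bC; clear; lia.
Qed.

(** Markov's inequality: averaged over one fresh vertex of T, the codegree is at
    most p. *)
Lemma Ex_high_le X (f : Om -> R) (T : {set I}) (t : R) : dep X f ->
  (forall w, 0 <= f w) -> 0 < t -> #|T| = k.-1 -> (#|T :&: X| <= k - 2)%N ->
  Ex (fun w => f w * (high t w T)%:R) <= p / t * Ex f.
Proof.
move=> dX f0 t0 Tk TX.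
have /card_gt0P[a] : (0 < #|T :\: X|)%N.
  by have := cardsID X T; move: Tk TX k_ge4; clear; lia.
rewrite !inE => /andP[aX aT]; have aC : a \notin T :\ a by rewrite !inE eqxx.
rewrite -ExZr; apply: (Ex_upd_le dX aX) => // w; rewrite /high.
rewrite -{1}(setD1K aT); under eq_bigr do rewrite imset_upd//.
have h : (\sum_x codeg (x |: w @: (T :\ a))) / n <= p.
  apply: G_deg_le; apply: leq_trans (leq_imset_card _ _) _.
  by move: Tk k_ge4; rewrite (cardsD1 a) aT; clear; lia.
apply: le_trans (_ : ((\sum_x codeg (x |: w @: (T :\ a))) / n) / t <= _); last first.
  by rewrite ler_wpM2r ?invr_ge0 ?(ltW t0).
rewrite mulrAC ler_wpM2r ?invr_ge0// mulr_suml; apply: ler_sum => x _.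
case: (leP t) => [h'|_] /=; last by rewrite mulr_ge0 ?codeg_ge0 ?invr_ge0 ?(ltW t0).
by rewrite ler_pdivlMr// mul1r.
Qed.

(** The fresh vertex x completes T with probability at most the codegree of T. *)
Lemma Ex_low_le X (f : Om -> R) (T : {set I}) x (t : R) : dep X f ->
  (forall w, 0 <= f w) -> 0 <= t -> T \subset X -> x \notin X ->
  Ex (fun w => f w * ((~~ high t w T)%:R * (x |: T \in pullback w)%:R))
    <= t * Ex f.
Proof.
move=> dX f0 t0 TX xX.
have xT : x \notin T by apply: contra xX => /(subsetP TX).
rewrite -ExZr; apply: (Ex_upd_le dX xX) => // w.
have wT y : upd w x y @: T = w @: T.
  apply: eq_in_imset => i iT; rewrite ffunE; case: eqP => // ix.
  by rewrite -ix iT in xT.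
under eq_bigr do rewrite /high wT.
rewrite -mulr_sumr -mulrA.
case: (leP t) => [_|h]; first by rewrite mul0r.
rewrite mul1r; apply: le_trans (ltW h); rewrite /codeg ler_wpM2r ?invr_ge0//.
apply: ler_sum => y _; rewrite inE imset_upd// ler_nat; by case: (_ == _); case: (_ \in G).
Qed.

Lemma Ex_collision (x y : I) : x != y -> Ex (fun w : Om => (w x == w y)%:R) = n^-1.
Proof.
move=> xy; rewrite (Ex_upd V_gt0 x) (eq_Ex (g := fun=> n^-1)) ?Ex_cst// => w.
under eq_bigr do rewrite !ffunE eqxx eq_sym [y == x]eq_sym (negbTE xy).
rewrite (bigD1 (w y))//= eqxx big1 ?addr0 ?mul1r//.
by move=> z /negbTE; rewrite eq_sym => ->.
Qed.

Lemma dep_edge (e : {set I}) : dep e (fun w => (e \in pullback w)%:R : R).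
Proof.
by move=> w z wz; rewrite !inE (eq_in_imset wz).
Qed.

Lemma depM X Y (f g : Om -> R) : dep X f -> dep Y g ->
  dep (X :|: Y) (fun w => f w * g w).
Proof.
move=> dX dY w z wz; congr (_ * _).
  by apply: dX => i iX; apply: wz; rewrite inE iX.
by apply: dY => i iY; apply: wz; rewrite inE iY orbT.
Qed.

Lemma sum_le_card (T : finType) (P : pred T) (F : T -> R) c m : 0 <= c ->
  (#|P| <= m)%N -> (forall x, P x -> F x <= c) -> \sum_(x | P x) F x <= m%:R * c.
Proof.
move=> c0 Pm Fc; apply: le_trans (_ : \sum_(x | P x) c <= _).
  by apply: ler_sum => x /Fc.
by rewrite sumr_const -[c *+ _]mulr_natl ler_wpM2r// ler_nat.
Qed.

Lemma card_supersets_pred (A : {set I}) m j (P : pred {set I}) :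
  (forall e, P e -> #|e| = m /\ A \subset e) -> (m - #|A| = j)%N ->
  (#|P| <= #|I| ^ j)%N.
Proof.
move=> PA <-; apply: leq_trans (card_supersets A m).
by apply/subset_leq_card/subsetP => e /PA[em Ae]; rewrite inE em eqxx.
Qed.

(** A fresh edge costs a factor s^(k-1) p, with k choices for the next vertex. The
    closing edge has two prescribed vertices and costs s^(k-2) p only; the factor s
    gained here is what makes short cycles rare. *)
Lemma Ex_cycle_count_le l (y : I) (X : {set I}) (v : I) (f : Om -> R) :
  dep X f -> (forall w, 0 <= f w) ->
  v \in X -> y \in X -> v != y ->
  Ex (fun w => f w * cycle_count R k (pullback w) l y X v) <=
    (k%:R * (s ^+ k.-1 * p)) ^+ l * (s ^+ (k - 2) * p) * Ex f.
Proof.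
elim: l X v f => [|l IH] X v f dX f0 vX yX vy.
  under eq_Ex => w do rewrite /= mulr_sumr.
  rewrite Ex_sum expr0 mul1r -mulrA -natrX; apply: sum_le_card.
  - by rewrite mulr_ge0// Ex_ge0.
  - apply: (@card_supersets_pred [set v; y] k); last by rewrite cards2 vy.
    by move=> e /andP[/eqP ek /eqP <-]; rewrite ek subsetIl.
  - move=> e /andP[/eqP ek /eqP eX]; apply: Ex_edge_le dX f0 ek _.
    by rewrite eX cards2 vy; move: k_ge4; clear; lia.
under eq_Ex => w do rewrite /= mulr_sumr.
rewrite Ex_sum.
pose K := (k%:R * (s ^+ k.-1 * p)) ^+ l * (s ^+ (k - 2) * p).
have K0 : 0 <= K by rewrite mulr_ge0 ?exprn_ge0 ?mulr_ge0 ?exprn_ge0.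
have -> : (k%:R * (s ^+ k.-1 * p)) ^+ l.+1 * (s ^+ (k - 2) * p) * Ex f =
  (#|I| ^ k.-1)%:R * (k%:R * (K * (p * Ex f))) by rewrite natrX /K exprS; ring.
have f1 : 0 <= Ex f by exact: Ex_ge0.
have Kf0 : 0 <= K * (p * Ex f) by exact: mulr_ge0 K0 (mulr_ge0 p_ge0 f1).
apply: sum_le_card; first by do ?[by []|apply: mulr_ge0].
- apply: (@card_supersets_pred [set v] k); last by rewrite cards1 subn1.
  by move=> e /andP[/eqP ek /eqP <-]; rewrite ek subsetIl.
move=> e /andP[/eqP ek /eqP eX].
under eq_Ex => w do rewrite mulr_sumr.
rewrite Ex_sum; apply: sum_le_card => //.
  rewrite -ek; apply/subset_leq_card/subsetP => u.
  by rewrite inE => /andP[].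
move=> u; rewrite !inE => /andP[uv ue].
under eq_Ex => w do rewrite mulrA.
apply: le_trans (IH (X :|: e) u _ (depM dX (@dep_edge e)) _ _ _ _) _.
- by move=> w; rewrite mulr_ge0.
- by rewrite inE ue orbT.
- by rewrite inE yX.
- apply: contra_neq vy => uy; have : y \in e :&: X by rewrite inE yX -uy ue.
  by rewrite eX inE => /eqP.
apply: ler_wpM2l => //; apply: Ex_edge_le dX f0 ek _.
by rewrite eX cards1; move: k_ge4; clear; lia.
Qed.

Variables (N b : nat).
Hypothesis I_gt0 : (0 < #|I|)%N.
Hypothesis b_gt0 : (0 < b)%N.
Hypothesis p_le : s ^+ k.-1 * p <= b%:R.
Hypothesis V_large : (16 * #|I| <= #|V|)%N.
Hypothesis I_large : (16 * (256 * k * b ^ 4 + b ^ 2 +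
  (k * b ^ 2 + 16 * b ^ 3) * (N * (k * b) ^ N)) <= 3 * #|I|)%N.

(** Sets T of codegree at least high_cut are rare enough to be deleted, and pairs
    of edges meeting in a set of codegree below low_cut as well. The sets between the
    two cuts can be neither deleted nor neglected; they become the cores of clusters. *)
Definition low_cut : R := (16 * s * b%:R)^-1.
Definition high_cut : R := 16 * b%:R / s.
Definition degree_cut : R := 8 * b%:R.

Let s_gt0 : 0 < s. Proof. by rewrite ltr0n. Qed.
Let b_gt0R : 0 < b%:R :> R. Proof. by rewrite ltr0n. Qed.
Let low_cut_gt0 : 0 < low_cut. Proof. by rewrite invr_gt0 !mulr_gt0. Qed.
Let high_cut_gt0 : 0 < high_cut. Proof. by rewrite divr_gt0 ?mulr_gt0. Qed.
Let degree_cut_gt0 : 0 < degree_cut. Proof. by rewrite mulr_gt0. Qed.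

Let k2E : k.-1.-1 = (k - 2)%N.
Proof. by rewrite subn2. Qed.

Definition through (m : nat) (x : I) : pred {set I} :=
  fun e => (#|e| == m) && (x \in e).

(** Each weight bad_... counts unwanted configurations of the sample at a vertex
    of theirs, which is to be deleted when the weight is at least 1. *)
Definition bad_high (w : Om) (x : I) : R :=
  \sum_(T | through k.-1 x T) (high high_cut w T)%:R.

(** No edge is required to contain the two sets: each of the two vertices that
    complete their common part makes it high with probability at most p / low_cut,
    which is rare enough. *)
Definition bad_two_cores (w : Om) (x : I) : R :=
  \sum_(T | through k.-1 x T) \sum_(a in T) \sum_(u in ~: T)
    (high low_cut w T)%:R * (high low_cut w (u |: (T :\ a)))%:R.

Definition bad_overlap (w : Om) (x : I) : R :=
  \sum_(y in [set~ x]) \sum_(e | through k x e && (y \in e))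
    \sum_(f | [&& through k x f, y \in f & (#|e :&: f| <= k - 2)%N])
      (e \in pullback w)%:R * (f \in pullback w)%:R.

Definition bad_low (w : Om) (x : I) : R :=
  \sum_(T | through k.-1 x T) \sum_(a in ~: T) \sum_(u in ~: (a |: T))
    (a |: T \in pullback w)%:R *
      ((~~ high low_cut w T)%:R * (u |: T \in pullback w)%:R).

(** Cycles whose consecutive edges share one vertex; bad_core_cycle deals with
    those that pass through one core T from the petal a to the petal u. *)
Definition bad_cycle (w : Om) (x : I) : R :=
  \sum_(e | through k x e) \sum_(v in e :\ x) \sum_(l < N)
    (e \in pullback w)%:R * cycle_count R k (pullback w) l x e v.

Definition bad_core_cycle (w : Om) (x : I) : R :=
  \sum_(T | through k.-1 x T) \sum_(a in ~: T) \sum_(u in ~: (a |: T)) \sum_(l < N)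
    ((a |: T \in pullback w)%:R *
      ((~~ high high_cut w T)%:R * (u |: T \in pullback w)%:R)) *
      cycle_count R k (pullback w) l u (u |: (a |: T)) a.

Definition bad_collision (w : Om) (x : I) : R := \sum_(y in [set~ x]) (w x == w y)%:R.

Definition bad_degree (w : Om) (x : I) : R :=
  (\sum_(e | through k x e) (e \in pullback w)%:R) / degree_cut.

Lemma card_through m x : (#|through m x| <= #|I| ^ m.-1)%N.
Proof.
apply: (@card_supersets_pred [set x] m); last by rewrite cards1 subn1.
by move=> e /andP[/eqP -> xe]; rewrite sub1set.
Qed.

Let dep1 : dep finset.set0 (fun _ : Om => 1 : R). Proof. by []. Qed.

Lemma Ex_edge (e : {set I}) : #|e| = k -> Ex (fun w => (e \in pullback w)%:R) <= p.
Proof.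
move=> ek; rewrite -[leRHS]mulr1 -[X in p * X](Ex_cst I V_gt0 1).
have := Ex_edge_le dep1 (fun=> ler01) ek; rewrite setI0 cards0 => /(_ isT).
by apply: le_trans; apply: Ex_le => w; rewrite mul1r.
Qed.

Lemma Ex_high (T : {set I}) (t : R) : 0 < t -> #|T| = k.-1 ->
  Ex (fun w => (high t w T)%:R) <= p / t.
Proof.
move=> t0 Tk; rewrite -[leRHS]mulr1 -[X in p / t * X](Ex_cst I V_gt0 1).
have := Ex_high_le dep1 (fun=> ler01) t0 Tk; rewrite setI0 cards0 => /(_ isT).
by apply: le_trans; apply: Ex_le => w; rewrite mul1r.
Qed.

Lemma dep_high t (T : {set I}) : dep T (fun w => (high t w T)%:R : R).
Proof. by move=> w z wz; rewrite /high (eq_in_imset wz). Qed.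

Lemma Ex_bad_high x : Ex (fun w => bad_high w x) <= s ^+ (k - 2) * (p / high_cut).
Proof.
rewrite Ex_sum -natrX.
have pt : 0 <= p / high_cut by rewrite divr_ge0// ltW.
apply: sum_le_card => //.
  by rewrite -k2E; exact: card_through.
by move=> T /andP[/eqP Tk _]; exact: Ex_high.
Qed.

Lemma Ex_bad_two_cores x : Ex (fun w => bad_two_cores w x) <=
  s ^+ (k - 2) * (k%:R * (s * (p / low_cut * (p / low_cut)))).
Proof.
have pt : 0 <= p / low_cut by rewrite divr_ge0// ltW.
have pt2 := mulr_ge0 pt pt.
rewrite Ex_sum -natrX; apply: sum_le_card; first by do ?[by []|apply: mulr_ge0].
  by rewrite -k2E; exact: card_through.
move=> T /andP[/eqP Tk _]; rewrite Ex_sum.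
apply: sum_le_card; first by do ?[by []|apply: mulr_ge0].
  by rewrite Tk leq_pred.
move=> a aT; rewrite Ex_sum; apply: sum_le_card => //.
  by rewrite max_card.
move=> u; rewrite inE => uT.
have cT : #|T :\ a| = (k - 2)%N by move: Tk k_ge4; rewrite (cardsD1 a) aT; clear; lia.
have uTa : u \notin T :\ a by rewrite inE negb_and uT orbT.
apply: le_trans (Ex_high_le (@dep_high low_cut T) _ low_cut_gt0 _ _) _.
- by move=> w.
- by rewrite cardsU1 uTa cT; move: k_ge4; clear; lia.
- rewrite -cT; apply/subset_leq_card/subsetP => z; rewrite !inE.
  by case: eqP => [->|_] //=; rewrite ?(negbTE uT) ?andbF// => /andP[].
by rewrite ler_wpM2l// Ex_high.
Qed.

Lemma Ex_bad_overlap x : Ex (fun w => bad_overlap w x) <=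
  s * (s ^+ (k - 2) * (s ^+ (k - 2) * (p * p))).
Proof.
rewrite Ex_sum -!natrX; apply: sum_le_card; first by do ?[by []|apply: mulr_ge0].
  by rewrite max_card.
move=> y; rewrite !inE => yx; rewrite Ex_sum.
have cxy : #|[set x; y]| = 2%N by rewrite cards2 eq_sym yx.
apply: sum_le_card; first by do ?[by []|apply: mulr_ge0].
  apply: (@card_supersets_pred [set x; y] k); last by rewrite cxy.
  move=> e /andP[/andP[/eqP -> xe] ye]; split=> //.
  by apply/subsetP => z; rewrite !inE => /orP[] /eqP ->.
move=> e /andP[/andP[/eqP ek xe] ye]; rewrite Ex_sum.
apply: sum_le_card; first by do ?[by []|apply: mulr_ge0].
  apply: (@card_supersets_pred [set x; y] k); last by rewrite cxy.
  move=> f /and3P[/andP[/eqP -> xf] yf _]; split=> //.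
  by apply/subsetP => z; rewrite !inE => /orP[] /eqP ->.
move=> f /and3P[/andP[/eqP fk xf] yf ef].
apply: le_trans (Ex_edge_le (@dep_edge e) _ fk _) _ => //.
  by rewrite setIC.
by rewrite ler_wpM2l// Ex_edge.
Qed.

Lemma Ex_sunflower (T : {set I}) a u (t : R) : #|T| = k.-1 -> 0 < t -> a \in ~: T ->
  u \in ~: (a |: T) ->
  Ex (fun w => (a |: T \in pullback w)%:R *
      ((~~ high t w T)%:R * (u |: T \in pullback w)%:R)) <= t * p.
Proof.
move=> Tk t0; rewrite !in_setC => aT uaT.
apply: le_trans (Ex_low_le (@dep_edge (a |: T)) _ (ltW t0) _ uaT) _ => //.
  exact: subsetUr.
by rewrite ler_wpM2l ?(ltW t0)// Ex_edge// cardsU1 aT Tk; move: k_ge4; clear; lia.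
Qed.

Lemma Ex_bad_low x : Ex (fun w => bad_low w x) <=
  s ^+ (k - 2) * (s * (s * (low_cut * p))).
Proof.
have lp : 0 <= low_cut * p by rewrite mulr_ge0// ltW.
rewrite Ex_sum -natrX; apply: sum_le_card; first by do ?[by []|apply: mulr_ge0].
  by rewrite -k2E; exact: card_through.
move=> T /andP[/eqP Tk _]; rewrite Ex_sum.
apply: sum_le_card => [||a aT];
  [by do ?[by []|apply: mulr_ge0]|by rewrite max_card|].
rewrite Ex_sum; apply: sum_le_card => [||u uT];
  [by do ?[by []|apply: mulr_ge0]|by rewrite max_card|].
exact: Ex_sunflower.
Qed.

Local Notation cycfac l := ((k%:R * (s ^+ k.-1 * p)) ^+ l * (s ^+ (k - 2) * p)).

Let cycfac_ge0 l : 0 <= cycfac l.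
Proof. by apply: mulr_ge0; [apply: exprn_ge0|]; rewrite !mulr_ge0 ?exprn_ge0. Qed.

Lemma Ex_bad_cycle x : Ex (fun w => bad_cycle w x) <=
  s ^+ k.-1 * (k%:R * \sum_(l < N) cycfac l * p).
Proof.
have S0 : 0 <= \sum_(l < N) cycfac l * p.
  by apply: sumr_ge0 => l _; apply: mulr_ge0 => //; exact: cycfac_ge0.
rewrite Ex_sum -[X in _ <= X * _]natrX; apply: sum_le_card;
  [exact: mulr_ge0|exact: card_through|].
move=> e /andP[/eqP ek xe]; rewrite Ex_sum; apply: sum_le_card => //.
  by rewrite -ek subset_leq_card// subsetDl.
move=> v; rewrite !inE => /andP[vx ve]; rewrite Ex_sum; apply: ler_sum => l _.
apply: le_trans (Ex_cycle_count_le _ (@dep_edge e) _ ve xe vx) _ => //.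
by rewrite ler_wpM2l ?cycfac_ge0// Ex_edge.
Qed.

Lemma Ex_bad_core_cycle x : Ex (fun w => bad_core_cycle w x) <=
  s ^+ (k - 2) * (s * (s * \sum_(l < N) cycfac l * (high_cut * p))).
Proof.
have hp : 0 <= high_cut * p by rewrite mulr_ge0// ltW.
have S0 : 0 <= \sum_(l < N) cycfac l * (high_cut * p).
  by apply: sumr_ge0 => l _; apply: mulr_ge0 => //; exact: cycfac_ge0.
rewrite Ex_sum -[X in _ <= X * _]natrX; apply: sum_le_card; first by do ?[by []|apply: mulr_ge0].
  by rewrite -k2E; exact: card_through.
move=> T /andP[/eqP Tk _]; rewrite Ex_sum.
apply: sum_le_card => [||a aT];
  [by do ?[by []|apply: mulr_ge0]|by rewrite max_card|].
rewrite Ex_sum; apply: sum_le_card; rewrite ?max_card// => u uT.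
rewrite Ex_sum; apply: ler_sum => l _.
apply: le_trans (Ex_cycle_count_le _ (X := u |: (a |: T)) _ _ _ _ _) _.
- apply: (@dep_sub I V _ ((a |: T) :|: (T :|: (u |: T)))).
    by apply/subsetP => z; rewrite !inE; case: (z == a); case: (z \in T); case: (z == u).
  apply: depM (@dep_edge _) _; apply: depM (@dep_edge _).
  by move=> w z wz; rewrite /high (eq_in_imset wz).
- by move=> w; rewrite !mulr_ge0.
- by rewrite !inE eqxx orbT.
- by rewrite !inE eqxx.
- by move: uT; rewrite !inE eq_sym negb_or => /andP[].
by rewrite ler_wpM2l ?cycfac_ge0// Ex_sunflower.
Qed.

Lemma Ex_bad_collision x : Ex (fun w => bad_collision w x) <= s * n^-1.
Proof.
rewrite Ex_sum; apply: sum_le_card; rewrite ?invr_ge0 ?ler0n ?max_card//.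
by move=> y; rewrite !inE eq_sym => yx; rewrite Ex_collision.
Qed.

Lemma Ex_bad_degree x : Ex (fun w => bad_degree w x) <= s ^+ k.-1 * p / degree_cut.
Proof.
rewrite (eq_Ex (g := fun w => degree_cut^-1 * \sum_(e | through k x e) (e \in pullback w)%:R)).
  rewrite ExZ [leRHS]mulrC ler_wpM2l ?invr_ge0 ?(ltW degree_cut_gt0)// Ex_sum -natrX.
  apply: sum_le_card; rewrite ?card_through// => e /andP[/eqP ek _].
  exact: Ex_edge.
by move=> w; rewrite mulrC.
Qed.

Definition bad (w : {ffun I -> V}) (x : I) : R :=
  bad_high w x + (bad_two_cores w x + (bad_overlap w x +
  (bad_low w x + (bad_cycle w x + (bad_core_cycle w x +
  (bad_collision w x + bad_degree w x)))))).

Let q := s ^+ (k - 2).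
Let beta := s * q * p.
Let qE : s ^+ k.-1 = s * q.
Proof. by rewrite -exprS; congr (_ ^+ _); move: k_ge4; clear; lia. Qed.
Let q_gt0 : 0 < q. Proof. by rewrite exprn_gt0. Qed.
Let q_ge : s ^+ 2 <= q.
Proof. have h : (2 <= k - 2)%N by move: k_ge4; clear; lia.
by apply: ler_weXn2l h; rewrite ler1n. Qed.
Let beta_ge0 : 0 <= beta. Proof. by rewrite !mulr_ge0// ltW. Qed.
Let beta_le : beta <= b%:R. Proof. by rewrite /beta -qE. Qed.
Let beta2_le : beta ^+ 2 <= b%:R ^+ 2. Proof. by rewrite lerXn2r ?nnegrE. Qed.
Let k_gt0 : 0 < k%:R :> R. Proof. by rewrite ltr0n (leq_trans _ k_ge4). Qed.

Let B (m : nat) := (k%:R * (s ^+ k.-1 * p)) ^+ m.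

Lemma sumB_le : \sum_(l < N) B l <= (N * (k * b) ^ N)%:R.
Proof.
rewrite natrM; apply: (sum_le_card (P := predT)) => [||l _]; rewrite ?ler0n//.
  by rewrite card_ord.
apply: le_trans (_ : (k * b)%:R ^+ l <= _).
  have h : k%:R * (s ^+ k.-1 * p) <= (k * b)%:R by rewrite natrM ler_wpM2l// ltW.
  by apply: lerXn2r => //; rewrite nnegrE// mulr_ge0 ?mulr_ge0 ?exprn_ge0.
rewrite -natrX ler_nat; apply: leq_pexp2l; last exact: ltnW (ltn_ord l).
by rewrite muln_gt0 b_gt0 (leq_trans _ k_ge4).
Qed.

Lemma beta_div_le c : 0 < c -> beta / (c * b%:R) <= c^-1.
Proof.
move=> c0; rewrite ler_pdivrMr ?mulr_gt0// mulrA mulVf ?gt_eqF// mul1r; exact: beta_le.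
Qed.

(** The expectations are in turn at most 1/16, O(1/s), O(1/s), 1/16, O(1/s),
    O(1/s), 1/16 and 1/8, and I_large makes the terms O(1/s) small. *)
Lemma Ex_bad_le x : Ex (fun w => bad w x) <= 2^-1.
Proof.
have s0 : s != 0 by rewrite gt_eqF.
have b0 : b%:R != 0 :> R by rewrite gt_eqF.
have q0 : q != 0 by rewrite gt_eqF.
have SB0 : 0 <= \sum_(l < N) B l.
  by apply: sumr_ge0 => l _; rewrite exprn_ge0 ?mulr_ge0 ?exprn_ge0.
have h1 : Ex (fun w => bad_high w x) <= 16^-1.
  apply: le_trans (Ex_bad_high x) _.
  rewrite -/q [leLHS](_ : _ = beta / (16 * b%:R)) ?beta_div_le//.
  by rewrite /high_cut /beta; field; rewrite b0 s0.
have h2 : Ex (fun w => bad_two_cores w x) <= 256 * k%:R * b%:R ^+ 4 / s.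
  apply: le_trans (Ex_bad_two_cores x) _.
  rewrite -/q [leLHS](_ : _ = 256 * k%:R * b%:R ^+ 2 * (beta ^+ 2 * (s / q))); last first.
    by rewrite /low_cut /beta; field; rewrite b0 q0.
  rewrite [leRHS](_ : _ = 256 * k%:R * b%:R ^+ 2 * (b%:R ^+ 2 * s^-1)); last first.
    by field.
  apply: ler_wpM2l; first by rewrite mulr_ge0 ?exprn_ge0// mulr_ge0// ltW.
  apply: ler_pM => //; first by rewrite exprn_ge0.
    by rewrite divr_ge0// ltW.
  by rewrite ler_pdivrMr// mulrC ler_pdivlMr// -expr2.
have h3 : Ex (fun w => bad_overlap w x) <= b%:R ^+ 2 / s.
  apply: le_trans (Ex_bad_overlap x) _.
  rewrite -/q [leLHS](_ : _ = beta ^+ 2 / s); first by rewrite ler_wpM2r ?invr_ge0 ?(ltW s_gt0).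
  by rewrite /beta; field.
have h4 : Ex (fun w => bad_low w x) <= 16^-1.
  apply: le_trans (Ex_bad_low x) _.
  rewrite -/q [leLHS](_ : _ = beta / (16 * b%:R)) ?beta_div_le//.
  by rewrite /low_cut /beta; field; rewrite ?b0 ?s0.
have h5 : Ex (fun w => bad_cycle w x) <=
    k%:R * b%:R ^+ 2 * (N * (k * b) ^ N)%:R / s.
  apply: le_trans (Ex_bad_cycle x) _.
  rewrite -!mulr_suml -/q -/(B _) qE; have := sumB_le; set S := (N * _)%:R => SB.
  rewrite [leLHS](_ : _ = k%:R / s * (beta ^+ 2 * \sum_(l < N) B l)); last first.
    by rewrite /beta /B qE; field.
  rewrite [leRHS](_ : _ = k%:R / s * (b%:R ^+ 2 * S)); last by field.
  apply: ler_wpM2l; first by rewrite divr_ge0// ltW.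
  by apply: ler_pM => //; rewrite exprn_ge0.
have h6 : Ex (fun w => bad_core_cycle w x) <=
    16 * b%:R ^+ 3 * (N * (k * b) ^ N)%:R / s.
  apply: le_trans (Ex_bad_core_cycle x) _.
  rewrite -!mulr_suml -/q -/(B _) qE; have := sumB_le; set S := (N * _)%:R => SB.
  rewrite [leLHS](_ : _ = 16 * b%:R / s * (beta ^+ 2 * \sum_(l < N) B l)); last first.
    by rewrite /high_cut /beta /B qE; field.
  rewrite [leRHS](_ : _ = 16 * b%:R / s * (b%:R ^+ 2 * S)); last by field.
  apply: ler_wpM2l; first by rewrite divr_ge0 ?mulr_ge0// ltW.
  by apply: ler_pM => //; rewrite exprn_ge0.
have h7 : Ex (fun w => bad_collision w x) <= 16^-1.
  apply: le_trans (Ex_bad_collision x) _.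
  by rewrite ler_pdivrMr// mulrC ler_pdivlMr// mulrC -natrM ler_nat.
have h8 : Ex (fun w => bad_degree w x) <= 8^-1.
  apply: le_trans (Ex_bad_degree x) _.
  by rewrite qE -/beta /degree_cut beta_div_le.
rewrite /bad !ExD.
have : 16 * (256 * k%:R * b%:R ^+ 4 + b%:R ^+ 2 + (k%:R * b%:R ^+ 2 * (N * (k * b) ^ N)%:R +
    16 * b%:R ^+ 3 * (N * (k * b) ^ N)%:R)) <= 3 * s.
  rewrite -mulrDl.
  by rewrite -!(natrX, natrM, natrD) ler_nat.
set X := _ + _ => hX.
have {hX} : X / s <= 3 / 16 by rewrite (ler_pdivrMr _ _ s_gt0); lra.
rewrite /X !(mulrDl _ _ s^-1); lra.
Qed.

Lemma sum_ge1 (T : finType) (P : pred T) (F : T -> R) i :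
  P i -> (forall j, 0 <= F j) -> 1 <= F i -> 1 <= \sum_(j | P j) F j.
Proof. by move=> Pi F0 Fi; rewrite (bigD1 i)//= ler_wpDr// sumr_ge0. Qed.

Lemma bad_ge0 w x :
  [/\ 0 <= bad_high w x, 0 <= bad_two_cores w x,
      0 <= bad_overlap w x & 0 <= bad_low w x] /\
  [/\ 0 <= bad_cycle w x, 0 <= bad_core_cycle w x,
      0 <= bad_collision w x & 0 <= bad_degree w x].
Proof.
split; split; rewrite ?mulr_ge0 ?invr_ge0 ?(ltW degree_cut_gt0)//;
  do ![apply: sumr_ge0 => ? _ | apply: mulr_ge0 | exact: cycle_count_ge0 | by []].
Qed.

Lemma exists_good : exists w : {ffun I -> V},
  s / 2 <= #|[set x | bad w x < 1]|%:R.
Proof.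
have [w Hw] := Ex_exists_le V_gt0 (fun w : {ffun I -> V} => \sum_(x : I) bad w x).
exists w; set U := [set x | _].
have h : \sum_(x : I) bad w x <= s / 2.
  apply: le_trans Hw _; rewrite Ex_sum mulr_natl -sumr_const.
  by apply: ler_sum => x _; exact: Ex_bad_le.
have : #|~: U|%:R <= s / 2.
  apply: le_trans h; rewrite -sum1_card natr_sum big_mkcond /=.
  apply: ler_sum => x _; rewrite !inE -leNgt; case: ifP => // _.
  by have [[? ? ? ?] [? ? ? ?]] := bad_ge0 w x; rewrite /bad; do !apply: addr_ge0.
have : s = #|U|%:R + #|~: U|%:R by rewrite -natrD cardsC.
lra.
Qed.

Section Good.
Variable w : {ffun I -> V}.
Local Notation U := [set x | bad w x < 1].
Local Notation F := (pullback w).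
Implicit Types (T e f : {set I}).

Lemma good_parts x : x \in U ->
  [/\ bad_high w x < 1, bad_two_cores w x < 1,
      bad_overlap w x < 1 & bad_low w x < 1] /\
  [/\ bad_cycle w x < 1, bad_core_cycle w x < 1,
      bad_collision w x < 1 & bad_degree w x < 1].
Proof.
rewrite inE /bad; have [[? ? ? ?] [? ? ? ?]] := bad_ge0 w x.
by move=> ?; split; split; lra.
Qed.

Lemma card_F e : e \in F -> #|e| = k.
Proof. by rewrite inE => /andP[/eqP]. Qed.

Lemma good_high x T : x \in U -> through k.-1 x T -> ~~ high high_cut w T.
Proof.
move=> /good_parts[[h _ _ _] _] PT; apply: contraTN h => hT; rewrite -leNgt.
by apply: (sum_ge1 PT) => //; rewrite hT.
Qed.

Lemma good_two_cores x T a u : x \in U -> through k.-1 x T -> a \in T ->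
  u \in ~: T -> high low_cut w T -> ~~ high low_cut w (u |: (T :\ a)).
Proof.
move=> /good_parts[[_ h _ _] _] PT aT uT hT; apply: contraTN h => hT'.
rewrite -leNgt; apply: (sum_ge1 PT) => [T'|]; first by do ?[apply: sumr_ge0 => *].
apply: (sum_ge1 aT) => [a'|]; first by do ?[apply: sumr_ge0 => *].
by apply: (sum_ge1 uT) => //; rewrite hT hT' mul1r.
Qed.

Lemma good_overlap x y e f : x \in U -> y != x -> e \in F -> f \in F ->
  x \in e -> x \in f -> y \in e -> y \in f -> (k.-1 <= #|e :&: f|)%N.
Proof.
move=> /good_parts[[_ _ h _] _] yx eF fF xe xf ye yf; rewrite leqNgt.
apply: contraTN h => ef; rewrite -leNgt.
have yx' : y \in [set~ x] by rewrite !inE.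
apply: (sum_ge1 yx') => [y'|]; first by do ?[apply: sumr_ge0 => *].
apply: (sum_ge1 (i := e)) => [|e'|]; first by rewrite /through card_F// eqxx xe.
  by do ?[apply: sumr_ge0 => *].
apply: (sum_ge1 (i := f)) => //; last by rewrite eF fF mul1r.
by rewrite /through card_F// eqxx xf yf /=; move: ef k_ge4; clear; lia.
Qed.

Lemma good_low x T a u : x \in U -> through k.-1 x T -> a \in ~: T ->
  u \in ~: (a |: T) -> a |: T \in F -> u |: T \in F -> high low_cut w T.
Proof.
move=> /good_parts[[_ _ _ h] _] PT aT uT aF uF; apply: contraTT h => hT.
rewrite -leNgt; apply: (sum_ge1 PT) => [T'|]; first by do ?[apply: sumr_ge0 => *].
apply: (sum_ge1 aT) => [a'|]; first by do ?[apply: sumr_ge0 => *].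
by apply: (sum_ge1 uT) => //; rewrite aF uF hT !mul1r.
Qed.

Lemma good_cycle x e v (l : nat) : x \in U -> e \in F -> x \in e -> v \in e ->
  v != x -> (l < N)%N -> cycle_count R k F l x e v < 1.
Proof.
move=> /good_parts[_ [h _ _ _]] eF xe ve vx lN; apply: contraTT h.
rewrite -!leNgt => hc.
have Pe : through k x e by rewrite /through card_F// eqxx.
have cz l' y X z : 0 <= cycle_count R k F l' y X z by exact: cycle_count_ge0.
apply: (sum_ge1 Pe) => [e'|]; first by do ?[apply: sumr_ge0 => *]; rewrite mulr_ge0.
have ve' : v \in e :\ x by rewrite !inE vx.
apply: (sum_ge1 ve') => [e'|]; first by do ?[apply: sumr_ge0 => *]; rewrite mulr_ge0.
apply: (@sum_ge1 _ predT _ (Ordinal lN)) => // [l'|]; first by rewrite mulr_ge0.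
by rewrite eF mul1r.
Qed.

Lemma good_core_cycle x T a u (l : nat) : x \in U -> through k.-1 x T ->
  a \in ~: T -> u \in ~: (a |: T) -> a |: T \in F -> u |: T \in F -> (l < N)%N ->
  cycle_count R k F l u (u |: (a |: T)) a < 1.
Proof.
move=> xU PT aT uT aF uF lN; have hT := good_high xU PT.
have [_ [_ h _ _]] := good_parts xU; apply: contraTT h.
rewrite -!leNgt => hc.
have cz l' y X z : 0 <= cycle_count R k F l' y X z by exact: cycle_count_ge0.
apply: (sum_ge1 PT) => [e'|]; first by do ?[apply: sumr_ge0 => *]; rewrite !mulr_ge0.
apply: (sum_ge1 aT) => [e'|]; first by do ?[apply: sumr_ge0 => *]; rewrite !mulr_ge0.
apply: (sum_ge1 uT) => [e'|]; first by do ?[apply: sumr_ge0 => *]; rewrite !mulr_ge0.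
apply: (@sum_ge1 _ predT _ (Ordinal lN)) => // [l'|]; first by rewrite !mulr_ge0.
by rewrite aF uF hT !mul1r.
Qed.

Lemma good_inj : {in U &, injective w}.
Proof.
move=> x y /good_parts[_ [_ _ h _]] _ wxy; apply/eqP; apply: contraTT h => xy.
have yx : y \in [set~ x] by rewrite !inE eq_sym.
by rewrite -leNgt; apply: (sum_ge1 yx) => //; rewrite wxy eqxx.
Qed.

Lemma good_degree x : x \in U -> (#|[set e in F | x \in e]| <= 8 * b)%N.
Proof.
move=> /good_parts[_ [_ _ _]]; rewrite ltr_pdivrMr// mul1r => h.
rewrite -(ler_nat R) natrM; apply: le_trans (ltW h).
rewrite -sum1_card natr_sum big_mkcond [leRHS]big_mkcond /=.
apply: ler_sum => e _; rewrite inE; case: (boolP (e \in F)) => [eF|] /=.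
  by rewrite /through card_F// eqxx /=; case: (x \in e).
by case: ifP.
Qed.

Definition good_edges : {set {set I}} := [set e in F | e \subset U].

(** At most one u qualifies when e is a good edge (coreE). An edge without a high
    subset is a cluster of its own. *)
Definition core (e : {set I}) : {set I} :=
  if [pick u in e | high low_cut w (e :\ u)] is Some u then e :\ u else e.

Local Notation E := good_edges.

Lemma good_edgesP e : e \in E -> [/\ e \in F, #|e| = k & {subset e <= U}].
Proof.
by rewrite inE => /andP[eF /subsetP eU]; split=> //; exact: card_F.
Qed.

Lemma core_sub e : core e \subset e.
Proof. by rewrite /core; case: pickP => [u _|_] //; exact: subsetDl. Qed.

Lemma card_core e : e \in E -> (1 < #|core e|)%N.
Proof.
case/good_edgesP => _ ek _; rewrite /core; case: pickP => [u /andP[ue _]|_].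
  by move: ek; rewrite (cardsD1 u) ue; move: k_ge4; clear; lia.
by rewrite ek (leq_trans _ k_ge4).
Qed.

Lemma coreE e u : e \in E -> u \in e -> high low_cut w (e :\ u) -> core e = e :\ u.
Proof.
move=> eE ue hu; rewrite /core; case: pickP => [a /andP[ae ha]|/(_ u)]; last first.
  by rewrite ue hu.
have [eF ek eU] := good_edgesP eE.
have [->//|au] := eqVneq a u.
have aT : a \in e :\ u by rewrite !inE au.
have uT : u \in ~: (e :\ u) by rewrite !inE eqxx.
have PT : through k.-1 a (e :\ u).
  by rewrite /through aT andbT; move: ek; rewrite (cardsD1 u) ue => <-.
have := good_two_cores (eU _ ae) PT aT uT hu.
suff -> : u |: ((e :\ u) :\ a) = e :\ a by rewrite ha.
apply/setP => t; rewrite !inE; case: (t =P u) => [->|]//=.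
by rewrite eq_sym au ue.
Qed.

(** Only overlaps of k-1 vertices survive bad_overlap; by bad_low the common part is
    high, and by bad_two_cores it is then the core of both edges. *)
Lemma overlap_core e f x y : e \in E -> f \in E -> e != f -> x != y ->
  x \in e :&: f -> y \in e :&: f -> #|e :&: f| = k.-1 /\ core e = core f.
Proof.
move=> eE fE ef xy xef; rewrite inE => /andP[ye yf].
have := xef; rewrite inE => /andP[xe xf].
have [[eF ek eU] [fF fk fU]] := (good_edgesP eE, good_edgesP fE).
have := good_overlap (eU _ ye) xy eF fF ye yf xe xf => h.
have h2 : (#|e :&: f| < k)%N.
  rewrite -ek ltn_neqAle subset_leq_card ?subsetIl// andbT.
  apply: contra ef => /eqP h2; rewrite eqEcard ek fk leqnn andbT.
  by apply/setIidPl/eqP; rewrite eqEcard subsetIl h2 leqnn.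
have cT : #|e :&: f| = k.-1 by move: h h2; clear; lia.
have ed (g : {set I}) : #|g| = k -> e :&: f \subset g ->
    exists2 a, a \in g :\: (e :&: f) & g = a |: (e :&: f).
  move=> gk sg; have : #|g :\: (e :&: f)| == 1%N.
    by rewrite cardsD (setIidPr sg) gk cT; move: k_ge4; clear; lia.
  case/cards1P => a ga; exists a; first by rewrite ga inE.
  by rewrite -{1}(setID g (e :&: f)) (setIidPr sg) ga setUC.
have [a aD ea] := ed e ek (subsetIl _ _).
have [u uD fu] := ed f fk (subsetIr _ _).
have [aT uT] : a \notin e :&: f /\ u \notin e :&: f.
  by move: aD uD; rewrite !in_setD => /andP[-> _] /andP[-> _].
have hT : high low_cut w (e :&: f).
  apply: (good_low (eU _ xe) (a := a) (u := u)).
  - by rewrite /through cT eqxx xef.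
  - by rewrite in_setC.
  - rewrite in_setC -ea; apply: contra uT => ue; rewrite inE ue.
    by move: uD; rewrite in_setD => /andP[].
  - by rewrite -ea.
  - by rewrite -fu.
have eT : e :\ a = e :&: f by rewrite {1}ea setU1K.
have fT : f :\ u = e :&: f by rewrite {1}fu setU1K.
split=> //; rewrite (coreE (u := a))// ?eT//; last by move: aD; rewrite in_setD => /andP[].
rewrite (coreE (u := u))// ?fT//; by move: uD; rewrite in_setD => /andP[].
Qed.

(** By induction on the length, the walk is fresh without its first or its last
    edge, so only these two edges can meet unexpectedly. If they share one vertex,
    the walk is counted by bad_cycle; if they share more, they have the same core, and
    the part of the walk between their petals is counted by bad_core_cycle. *)
Lemma walk_fresh m v s : (size s <= m <= N.+1)%N -> nbw E core finset.set0 v s ->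
  fresh [set v] v s.
Proof.
have c0 e : e \in E -> core e != finset.set0.
  by move=> eE; rewrite -card_gt0 ltnW// card_core.
elim: m v s => [|m IH] v s; first by case: s.
case: s => [//|[e1 w1] s']; case/lastP: s' => [|s [e2 z']] /andP[ss mN] ns.
  by move: ns => /= /and5P[_ ve _ _ _]; rewrite setIC (setIidPl _) ?eqxx ?sub1set.
have mN' : (m <= N.+1)%N by apply: ltnW.
have H1 : fresh [set v] v ((e1, w1) :: s).
  apply: IH; first by move: ss; rewrite /= size_rcons mN' andbT.
  by move: ns; rewrite -rcons_cons => /nbw_rcons[].
move: ns => /= /and5P[e1E ve1 w1e1 w1v /andP[_ ns]].
have H2 : fresh [set w1] w1 (rcons s (e2, z')).
  by apply: IH (nbw_set0 c0 ns); move: ss; rewrite /= !size_rcons mN' andbT.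
have [ns1 /and4P[e2E ze2 _ _]] := nbw_rcons ns.
set z := wend w1 s in ze2.
move: H1 => /= /andP[-> ]; rewrite (setUidPr _) ?sub1set// => f1 /=.
move: H2; rewrite !fresh_rcons f1 /= -/z => /andP[_ /eqP e2s].
have [e1F e1k e1U] := good_edgesP e1E; have [e2F e2k e2U] := good_edgesP e2E.
have zs : z \in w1 |: covered s.
  have : z \in e2 :&: (w1 |: covered s) by rewrite e2s inE.
  by rewrite inE => /andP[].
apply: contraT => nz.
have [y ye2 [yz yX]] : exists2 y, y \in e2 & y != z /\ y \in e1 :|: covered s.
  have /subsetPn[y] : ~~ (e2 :&: (e1 :|: covered s) \subset [set z]).
    apply: contra nz => sz; rewrite eqEsubset sz sub1set inE ze2.
    by move: zs; rewrite !inE => /orP[/eqP ->|->]; rewrite ?w1e1 ?orbT.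
  by rewrite in_setI in_set1 => /andP[ye2 yX] yz; exists y.
have yns : y \notin w1 |: covered s.
  apply: contra yz => ys; have : y \in e2 :&: (w1 |: covered s) by rewrite inE ye2.
  by rewrite e2s inE.
have [yw1 ycs] : y != w1 /\ y \notin covered s.
  by move: yns; rewrite !inE negb_or => /andP[].
have ye1 : y \in e1 by move: yX; rewrite inE (negbTE ycs) orbF.
(* Two consecutive edges that share y and w1 would have the same core. *)
have [s0|s0] := eqVneq s [::].
  have zw1 : z = w1 by rewrite /z s0.
  move: ns; rewrite s0 /= => /and5P[_ _ _ _ /andP[cc _]].
  have [ee|ee] := eqVneq e1 e2; first by rewrite ee eqxx in cc.
  have w1e2 : w1 \in e2 by rewrite -zw1.
  have [_ ce] : #|e1 :&: e2| = k.-1 /\ core e1 = core e2.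
    by apply: (overlap_core e1E e2E ee yw1); rewrite in_setI ?ye1 ?w1e1.
  by rewrite ce eqxx in cc.
have ze1 : z \notin e1 by exact: fresh_wend ns1 f1 s0.
have e12 : e1 != e2 by apply: contraNneq ze1 => ->.
have w1z : w1 != z by apply: contraNneq ze1 => <-.
have w1e2 : w1 \notin e2.
  apply: contra w1z => w1e2.
  have : w1 \in e2 :&: (w1 |: covered s) by rewrite !inE w1e2 eqxx.
  by rewrite e2s inE.
have e2cov t : t \in e2 -> t \in covered s -> t = z.
  move=> te2 ts; apply/eqP; have : t \in e2 :&: (w1 |: covered s).
    by rewrite !inE te2 ts orbT.
  by rewrite e2s inE.
have zcov : z \in covered s.
  by move: zs; rewrite !inE eq_sym (negbTE w1z).
have EF : E \subset F by apply/subsetP => e /good_edgesP[].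
have slt : (size s < N)%N by move: ss mN; rewrite /= size_rcons; clear; lia.
(* A cycle in which e1 and e2 share the vertex y only. *)
have [ey|ney] := eqVneq (e1 :&: e2) [set y].
  have := good_cycle (e1U _ ye1) e1F ye1 w1e1 _ slt; rewrite eq_sym => /(_ yw1).
  rewrite ltNge (cycle_count_ge1 R EF (@card_F) ns1 f1 e2F) -/z//.
  apply/setP => t; rewrite !inE; apply/idP/idP.
    move=> /andP[te2 /orP[te1|ts]]; last by rewrite (e2cov _ te2 ts) eqxx.
    by have : t \in e1 :&: e2; [rewrite inE te1|rewrite ey inE => ->; rewrite orbT].
  by move=> /orP[] /eqP ->; rewrite ?ze2 ?zcov ?ye1 ?ye2 ?orbT.
(* Now e1 and e2 are w1 |: T and z |: T for their common core T, and the last edge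
   e3 of s leads back to the petal z. *)
have [y' y'y y'e] : exists2 y', y' != y & y' \in e1 :&: e2.
  have /subsetPn[y'] : ~~ (e1 :&: e2 \subset [set y]).
    by apply: contra ney => sy; rewrite eqEsubset sy sub1set inE ye1.
  by rewrite [_ \in [set y]]inE => ? ?; exists y'.
have ye : y \in e1 :&: e2 by rewrite inE ye1.
have [cT _] := overlap_core e1E e2E e12 y'y y'e ye.
have addT (g : {set I}) a : #|g| = k -> e1 :&: e2 \subset g -> a \in g ->
    a \notin e1 :&: e2 -> g = a |: (e1 :&: e2).
  move=> gk sg ag aT; apply/esym/eqP; rewrite eqEcard subUset sub1set ag sg.
  by rewrite cardsU1 aT cT gk; move: k_ge4; clear; lia.
have w1T : w1 \notin e1 :&: e2 by rewrite inE (negbTE w1e2) andbF.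
have zT : z \notin e1 :&: e2 by rewrite inE (negbTE ze1).
have e1T := addT _ _ e1k (subsetIl _ _) w1e1 w1T.
have e2T := addT _ _ e2k (subsetIr _ _) ze2 zT.
have [s3 [[e3 z3] es]] : exists s3 r, s = rcons s3 r.
  by case/lastP: (s) s0 => [//|s3 r] _; exists s3, r.
have zE : z = z3 by rewrite /z es wend_rcons.
move: f1 ns1; rewrite es -zE fresh_rcons => /andP[f3 /eqP e3s].
move=> /nbw_rcons[ns3 /and4P[e3E w3e3 ze3 zw3]].
have z3c : z \notin e1 :|: covered s3.
  apply: contra zw3 => zc; have : z \in e3 :&: (e1 :|: covered s3) by rewrite inE ze3.
  by rewrite e3s inE.
have zcs : z \notin covered s3 by move: z3c; rewrite inE negb_or => /andP[].
have slt3 : (size s3 < N)%N.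
  by apply: leq_trans slt; rewrite es size_rcons.
have PT : through k.-1 y (e1 :&: e2) by rewrite /through cT eqxx.
have [e3F _ _] := good_edgesP e3E.
have := @good_core_cycle y (e1 :&: e2) w1 z (size s3) (e1U _ ye1) PT.
rewrite -e1T -e2T !in_setC => /(_ w1T ze1 e1F e2F slt3).
rewrite ltNge (cycle_count_ge1 R EF (@card_F) ns3 (fresh_add zcs f3) e3F)//.
by rewrite -setUA setIUr e3s setUC; congr (_ :|: _); apply/setIidPr; rewrite sub1set.
Qed.

Lemma good_acyclic v s : (0 < size s <= N.+1)%N -> nbw E core finset.set0 v s ->
  wend v s != v.
Proof.
move=> /andP[s0 sN] ns; have fs := walk_fresh (m := N.+1) _ ns.
have := fresh_wend ns (fs _); rewrite inE; apply; first by rewrite sN leqnn.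
by case: (s) s0.
Qed.

End Good.
End Sampling.

(** * Independent sets of size t *)

(** For b = mu M^(k-1), the exponent is the number 8 b (3 / M)^(k-1) of blocking
    edges to be expected at a vertex, and 16 exceeds exp 2 (expR_rounds). *)
Definition rounds (k mu : nat) : nat := (16 ^ (8 * 3 ^ k.-1 * mu))%N.

(** From this value of t on, a sample of 4 M t vertices is large enough to make
    cycles with O(M) edges rare. *)
Definition threshold (k mu : nat) : nat :=
  let M := rounds k mu in let b := (mu * M ^ k.-1)%N in
  (2 * (256 * k * b ^ 4 + b ^ 2 + (k * b ^ 2 + 16 * b ^ 3) * (2 * M * (k * b) ^ (2 * M))))%N.

Lemma expR1_le4 (R : realType) : expR 1 <= 4 :> R.
Proof.
have h : 2^-1 <= expR (- 2^-1) :> R.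
  by apply: le_trans (expR_ge1Dx _); lra.
have e : expR (2^-1) <= 2 :> R.
  rewrite expRN in h; rewrite -[leLHS]invrK -[leRHS]invrK.
  by rewrite lef_pV2 // posrE invr_gt0 // expR_gt0.
have -> : expR 1 = expR (2^-1) * expR (2^-1) :> R.
  by rewrite -expRD; congr expR; lra.
apply: le_trans (_ : 2 * 2 <= _); last by lra.
by apply: ler_pM => //; exact: expR_ge0.
Qed.

Lemma expR_rounds (R : realType) k mu :
  (rounds k mu)%:R^-1 <= expR (- (2 * (8 * 3 ^+ k.-1 * mu%:R))) :> R.
Proof.
rewrite expRN lef_pV2 ?posrE ?expR_gt0 ?ltr0n ?expn_gt0//.
rewrite /rounds; set l := (8 * 3 ^ k.-1 * mu)%N.
have -> : 2 * (8 * 3 ^+ k.-1 * mu%:R) = (2 * l)%:R * 1 :> R.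
  by rewrite mulr1 /l !natrM natrX.
rewrite expRM_natl natrX exprM.
apply: lerXn2r; rewrite ?nnegrE ?exprn_ge0 ?expR_ge0//.
apply: le_trans (_ : 4 ^+ 2 <= _); last by rewrite expr2; lra.
by apply: lerXn2r; rewrite ?nnegrE ?expR_ge0// expR1_le4.
Qed.

Section IndependentSet.
Variables (R : realType) (V : finType) (G : {set {set V}}) (k mu t : nat) (p : R).

(** At least half of a sample of 4 M t vertices survives, and each survivor is
    accepted with probability at least 1 / (2 M). *)
Lemma independent_set :
  (4 <= k)%N -> (0 < mu)%N -> (0 < t)%N -> (threshold k mu <= t)%N ->
  (16 * (4 * rounds k mu * t) <= #|V|)%N ->
  (forall e, e \in G -> #|e| = k) -> 0 <= p ->
  (4 * t%:R) ^+ k.-1 * p <= mu%:R ->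
  (forall C : {set V}, #|C| = (k - 2)%N ->
    \sum_x \sum_y (y |: (x |: C) \in G)%:R <= p * #|V|%:R ^+ 2) ->
  exists2 X : {set V}, #|X| = t & forall e, e \in G -> ~~ (e \subset X).
Proof.
move=> k4 mu0 t0 tt VL Gk p0 pmu Gdeg.
set M := rounds k mu in VL; pose b := (mu * M ^ k.-1)%N.
pose I := 'I_(4 * M * t).
have M0 : (0 < M)%N by rewrite expn_gt0.
have M16 : (16 <= M)%N.
  rewrite -[X in (X <= _)%N]expn1 leq_pexp2l//.
  by rewrite !muln_gt0 mu0 expn_gt0.
have b0 : (0 < b)%N by rewrite muln_gt0 mu0 expn_gt0 M0.
have I0 : (0 < #|{: I}|)%N by rewrite card_ord !muln_gt0 M0 t0.
have V0 : (0 < #|V|)%N by apply: leq_trans VL; rewrite !muln_gt0 M0 t0.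
have MR : 0 < M%:R :> R by rewrite ltr0n.
have Mne : M%:R != 0 :> R by rewrite gt_eqF.
have pb : #|{: I}|%:R ^+ k.-1 * p <= b%:R.
  rewrite card_ord (_ : (4 * M * t)%:R = M%:R * (4 * t%:R) :> R); last by rewrite !natrM; ring.
  by rewrite exprMn -mulrA /b natrM natrX mulrC ler_wpM2r// exprn_ge0.
have VL' : (16 * #|{: I}| <= #|V|)%N by rewrite card_ord.
have IL : (16 * (256 * k * b ^ 4 + b ^ 2 +
  (k * b ^ 2 + 16 * b ^ 3) * (2 * M * (k * b) ^ (2 * M))) <= 3 * #|{: I}|)%N.
  rewrite card_ord; move: tt; rewrite /threshold -/M -/b.
  set X := (256 * k * b ^ 4 + b ^ 2 + _)%N => tt.
  apply: leq_trans (_ : 8 * (2 * X) <= _)%N; first by rewrite mulnA.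
  apply: leq_trans (leq_mul (leqnn 8) tt) _; rewrite -!mulnA mulnA.
  by apply: leq_mul => //; rewrite leq_pmull.
have [w hw] := exists_good V0 k4 Gk p0 Gdeg I0 b0 pb VL' IL.
set U := [set x | _] in hw.
pose E := good_edges R G k (2 * M) b w; pose c := core R G b w.
have EP e : e \in E -> [/\ e \in pullback G k w, #|e| = k & {subset e <= U}].
  exact: good_edgesP.
have [W WU [/forall_inP Wind]] : exists2 W : {set I}, W \subset U &
    [forall e in E, ~~ (e \subset W)] /\
    #|U|%:R * (M%:R^-1 / 2) <= #|W|%:R :> R.
  apply: (@message_passing R I E c M k (8 * b) M%:R^-1 (3 / M%:R)) => //.
  - by move=> e /EP[].
  - by move=> e _; exact: core_sub.
  - by move=> e; exact: card_core.
  - move=> v s /andP[s0 sM]; apply: good_acyclic => //.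
    by rewrite s0 (leq_trans sM)// -mul2n.
  - move=> v; have [vU|vU] := boolP (v \in U).
      apply: leq_trans (good_degree b0 vU); apply/subset_leq_card/subsetP => e.
      by rewrite !inE -!andbA => /and4P[-> -> _ ->].
    rewrite (_ : [set e in E | v \in e] = finset.set0) ?cards0//.
    apply/setP => e; rewrite in_set0 in_set; apply/negP => /andP[eE ve].
    by have [_ _ /(_ _ ve)] := EP e eE; rewrite (negbTE vU).
  - by rewrite invr_gt0.
  - by rewrite -[X in X + _]mul1r -mulrDl; apply: ler_wpM2r; [rewrite invr_ge0|lra].
  - rewrite ler_pdivrMr// mulrC ler_pdivlMr// -natrM ler_nat; apply: leq_trans M16.
    by [].
  - have -> : (8 * b)%:R * (3 / M%:R) ^+ k.-1 = 8 * 3 ^+ k.-1 * mu%:R :> R.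
      rewrite /b !natrM natrX expr_div_n; field.
      by rewrite expf_neq0.
    exact: expR_rounds.
have wU : {in W &, injective w}.
  by move=> x y /(subsetP WU) xU /(subsetP WU) yU; exact: good_inj xU yU.
move=> Wcard; have tW : (t <= #|W|)%N.
  rewrite -(ler_nat R); apply: le_trans Wcard.
  apply: le_trans (_ : (#|{: I}|%:R / 2) * (M%:R^-1 / 2) <= _); last first.
    by rewrite ler_wpM2r// divr_ge0// invr_ge0.
  rewrite card_ord !natrM le_eqVlt; apply/orP; left; apply/eqP; field.
  exact: Mne.
have [X XW Xt] : exists2 X : {set I}, X \subset W & #|X| = t.
  exists [set x in take t (enum W)].
    by apply/subsetP => x; rewrite inE => /mem_take; rewrite mem_enum.
  have /card_uniqP : uniq (take t (enum W)) by rewrite take_uniq ?enum_uniq.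
  by rewrite cardsE => ->; rewrite size_take -cardE; case: ltngtP tW.
exists (w @: X).
  by rewrite card_in_imset// => x y /(subsetP XW) xW /(subsetP XW) yW; exact: wU.
move=> e eG; apply/negP => eX.
pose f := [set x in X | w x \in e].
have wf : w @: f = e.
  apply/setP => y; apply/imsetP/idP => [[x]|ye]; first by rewrite inE => /andP[_ xe] ->.
  have /imsetP[x xX yx] := subsetP eX y ye.
  by exists x => //; rewrite inE xX -yx.
have fW : f \subset W.
  by apply: subset_trans XW; apply/subsetP => x; rewrite inE => /andP[].
have fk : #|f| = k.
  rewrite -(Gk _ eG) -wf card_in_imset// => x y /(subsetP fW) xW /(subsetP fW) yW.
  exact: wU.
have fE : f \in E.
  by rewrite inE inE fk eqxx wf eG (subset_trans fW WU).
by have := Wind f fE; rewrite fW.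
Qed.

End IndependentSet.

(** * Growth of the threshold *)

Lemma leq_exp2 m : (m <= 2 ^ m)%N.
Proof. exact: ltnW (ltn_expl m (ltnSn 1)). Qed.

(** The threshold is about b^(2 M) with M exponential in mu, which makes it
    doubly exponential in mu. *)
Definition tower_rate (k : nat) : nat := (3 + 8 * (8 * 3 ^ k.-1) * k + 4 * (8 * 3 ^ k.-1))%N.

Lemma threshold_le k mu : (0 < k)%N -> (0 < mu)%N ->
  (threshold k mu <= 2 ^ (2 ^ (tower_rate k * mu)))%N.
Proof.
move=> k0 mu0; rewrite /threshold /tower_rate.
have ME : rounds k mu = (2 ^ (4 * (8 * 3 ^ k.-1) * mu))%N.
  by rewrite /rounds -[16%N]/(2 ^ 4)%N -expnM !mulnA.
have A0 : (0 < 8 * 3 ^ k.-1)%N by rewrite muln_gt0 expn_gt0.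
set A := (8 * 3 ^ k.-1)%N in ME A0 *; set M := rounds k mu in ME *.
pose m := (4 * A * mu)%N; pose a := (2 * m * k)%N.
have mu_m : (mu <= m)%N by rewrite leq_pmull// muln_gt0.
have m4 : (4 <= m)%N by rewrite /m -mulnA leq_pmulr// muln_gt0 A0.
have M0 : (0 < M)%N by rewrite ME expn_gt0.
have b_le : (mu * M ^ k.-1 <= 2 ^ (m * k))%N.
  apply: leq_trans (_ : 2 ^ m * 2 ^ (m * k.-1) <= _)%N.
    by rewrite leq_mul ?(leq_trans (leq_exp2 mu)) ?leq_exp2l// ME -expnM.
  by rewrite -expnD leq_exp2l// -mulnS prednK.
set b := (mu * M ^ k.-1)%N in b_le *.
have mk_le : (m * k <= a)%N by rewrite /a -mulnA mul2n -addnn leq_addr.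
have kb_le : (k * b <= 2 ^ a)%N.
  apply: leq_trans (leq_mul (leq_exp2 k) b_le) _.
  rewrite -expnD leq_exp2l// /a -mulnA mul2n -addnn leq_add2r leq_pmull//.
  by apply: leq_trans m4.
have b_le' : (b <= 2 ^ a)%N by apply: leq_trans b_le _; rewrite leq_exp2l.
have k_le : (k <= 2 ^ a)%N.
  apply: leq_trans (leq_exp2 k) _; rewrite leq_exp2l// /a leq_pmull//.
  by rewrite muln_gt0 (leq_trans _ m4).
have M_le : (M <= 2 ^ a)%N.
  by rewrite ME leq_exp2l// -/m /a mulnAC leq_pmull// muln_gt0.
have a8 : (8 <= a)%N by rewrite /a; move: m4 k0; clear; nia.
have h1 : (256 * k * b ^ 4 <= 2 ^ (8 + 5 * a))%N.
  rewrite expnD -mulnA -[256%N]/(2 ^ 8)%N leq_mul2l /=.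
  rewrite (_ : 5 * a = a + a * 4)%N; last by rewrite mulnC -mulnS.
  by rewrite expnD leq_mul// expnM leq_exp2r.
have h2 : (b ^ 2 <= 2 ^ (a * 2))%N by rewrite expnM leq_exp2r.
have h3 : (k * b ^ 2 + 16 * b ^ 3 <= 2 ^ (5 + a * 3))%N.
  apply: leq_trans (_ : 2 ^ (a * 3) + 16 * 2 ^ (a * 3) <= _)%N.
    apply: leq_add; last by rewrite leq_mul2l /= expnM leq_exp2r.
    by rewrite mulnS expnD leq_mul// expnM leq_exp2r.
  by rewrite expnD -[(2 ^ 5)%N]/32%N; move: (2 ^ (a * 3))%N => z; clear; lia.
have h4 : (2 * M * (k * b) ^ (2 * M) <= 2 ^ (1 + a + a * (2 * M)))%N.
  rewrite (expnD 2 (1 + a)) (expnD 2 1 a) !leq_mul// [leqRHS]expnM.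
  by rewrite leq_exp2r ?muln_gt0.
have h : (2 * (256 * k * b ^ 4 + b ^ 2 + (k * b ^ 2 + 16 * b ^ 3) * (2 * M * (k * b) ^ (2 * M)))
    <= 2 ^ (8 * a * M))%N.
  pose z := (9 + 5 * a + a * (2 * M))%N.
  apply: leq_trans (_ : 2 ^ (3 + z) <= _)%N; last first.
    rewrite leq_exp2l// /z; move: a8 M0; clear; nia.
  apply: leq_trans (_ : 2 * (2 ^ z + 2 ^ z + 2 ^ z) <= _)%N.
    rewrite leq_mul2l /= !leq_add//.
    - by apply: leq_trans h1 _; rewrite leq_exp2l// /z; clear; lia.
    - by apply: leq_trans h2 _; rewrite leq_exp2l// /z; clear; lia.
    - apply: leq_trans (leq_mul h3 h4) _; rewrite -expnD leq_exp2l// /z.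
      by move: a8; clear; lia.
  by rewrite expnD -[(2 ^ 3)%N]/8%N; move: (2 ^ z)%N => y; clear; lia.
apply: leq_trans h _; rewrite leq_exp2l//.
have -> : ((3 + 8 * A * k + 4 * A) * mu = 3 * mu + 8 * A * k * mu + 4 * A * mu)%N.
  by clear; lia.
rewrite (expnD 2 _ (4 * A * mu)%N) (expnD 2 (3 * mu)%N).
apply: leq_mul; last by rewrite ME.
apply: leq_mul.
  by rewrite -[8%N]/(2 ^ 3)%N leq_exp2l// leq_pmulr.
apply: leq_trans (leq_exp2 a) _; rewrite leq_exp2l// /a /m.
by rewrite leq_eqVlt; apply/orP; left; apply/eqP; clear; lia.
Qed.

(** * From independent sets to the density *)

Section Complement.
Variables (R : realType) (k n : nat) (H : {set {set 'I_n}}).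
Hypothesis k_ge4 : (4 <= k)%N.
Hypothesis H_unif : uniform k H.

Definition nonedges : {set {set 'I_n}} := [set e : {set 'I_n} | (#|e| == k) && (e \notin H)].

Lemma min_degree_le (S : {set 'I_n}) l : #|S| = l -> (min_degree l H <= degree H S)%N.
Proof.
move=> Sl; rewrite /min_degree.
have : S \in index_enum {set 'I_n} by rewrite mem_index_enum.
elim: (index_enum _) => // A r IH; rewrite inE big_cons.
case: eqP => [<- _|_ /= /IH h]; first by rewrite Sl eqxx geq_minl.
by case: ifP => // _; rewrite geq_min h orbT.
Qed.

(** Each edge of H that contains C arises from two ordered pairs (x, y). *)
Lemma sum_pairs_le (C : {set 'I_n}) : (#|C| = k - 2)%N ->
  (\sum_x \sum_y (y |: (x |: C) \in nonedges) + 2 * degree H C <= n * n.-1)%N.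
Proof.
move=> Ck; pose K := [set e in H | C \subset e].
have hH : (2 * degree H C <= \sum_x \sum_y (y |: (x |: C) \in H))%N.
  rewrite /degree -/K mulnC -sum_nat_const.
  apply: leq_trans (_ : \sum_(e in K) \sum_x \sum_y (y |: (x |: C) == e) <= _)%N.
    apply: leq_sum => e; rewrite inE => /andP[eH Ce].
    have ek : #|e| = k by move/forall_inP: H_unif => /(_ e eH)/eqP.
    have /cards2P[a [b [ab eab]]] : #|e :\: C| == 2%N.
      by rewrite cardsD (setIidPr Ce) ek Ck; move: k_ge4; clear; lia.
    have eE : a |: (b |: C) = e.
      by rewrite setUA -eab setUC -{1}(setIidPr Ce) setID.
    have eE' : b |: (a |: C) = e by rewrite -eE setUCA.
    have ga : (1 <= \sum_y (y |: (a |: C) == e))%N by rewrite (bigD1 b)//= eE' eqxx.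
    have gb : (1 <= \sum_y (y |: (b |: C) == e))%N by rewrite (bigD1 a)//= eE eqxx.
    rewrite (bigD1 a) //; apply: (leq_add ga).
    by rewrite (bigD1 b) /= ?[b == a]eq_sym //; apply: leq_trans gb (leq_addr _ _).
  rewrite exchange_big; apply: leq_sum => x _.
  rewrite exchange_big; apply: leq_sum => y _.
  case: (boolP (_ \in H)) => h.
    rewrite (bigD1 (y |: (x |: C))) /=; last first.
      by rewrite inE h /= setUA subsetUr.
    rewrite eqxx big1// => e /andP[_]; rewrite eq_sym => /negbTE -> //.
  rewrite big1// => e; rewrite inE => /andP[eH _].
  by case: eqP => // ee; rewrite ee eH in h.
apply: leq_trans (leq_add (leqnn _) hH) _.
rewrite -big_split /=; apply: leq_trans (_ : \sum_(x < n) \sum_(y < n) (y != x) <= _)%N.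
  apply: leq_sum => x _; rewrite -big_split; apply: leq_sum => y _ /=.
  rewrite inE; case: (boolP (_ \in H)) => hH' /=; rewrite ?andbF ?andbT /=.
    have : #|y |: (x |: C)| = k by move/forall_inP: H_unif => /(_ _ hH')/eqP.
    case: eqP => // ->; rewrite setUA setUid cardsU1 Ck.
    by move: k_ge4; case: (_ \notin _); clear; lia.
  rewrite addn0; have [->|_] := eqVneq y x; last exact: leq_b1.
  rewrite setUA setUid cardsU1 Ck.
  by case: eqP => //; move: k_ge4; case: (_ \notin _); clear; lia.
rewrite (eq_bigr (fun=> n.-1)); first by rewrite sum_nat_const card_ord.
move=> x _; rewrite -big_mkcond /= sum1_card.
by have := cardC1 x; rewrite card_ord => <-; apply: eq_card => y; rewrite !inE.
Qed.

Lemma nonedges_deg (p : R) (C : {set 'I_n}) : 0 <= p -> #|C| = (k - 2)%N ->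
  (1 - p) * 'C(n, 2)%:R < (min_degree (k - 2) H)%:R ->
  \sum_x \sum_y (y |: (x |: C) \in nonedges)%:R <= p * #|'I_n|%:R ^+ 2.
Proof.
move=> p0 Ck hdeg; have hC := sum_pairs_le Ck.
have bin : ('C(n, 2) * 2 = n * n.-1)%N.
  by rewrite bin2 muln2 halfK; case: (n) => // m; rewrite /= oddM /= andNb subn0.
set S := (\sum_x _)%N in hC.
have -> : \sum_x \sum_y (y |: (x |: C) \in nonedges)%:R = S%:R :> R.
  by rewrite natr_sum; apply: eq_bigr => x _; rewrite natr_sum.
have dC : (min_degree (k - 2) H)%:R <= (degree H C)%:R :> R.
  by rewrite ler_nat min_degree_le.
have hCR : S%:R + 2 * (degree H C)%:R <= 'C(n, 2)%:R * 2 :> R.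
  by rewrite -!natrM -natrD ler_nat bin.
have bin_le : 'C(n, 2)%:R * 2 <= n%:R ^+ 2 :> R.
  by rewrite -natrM -natrX ler_nat bin leq_mul2l leq_pred orbT.
rewrite card_ord; apply: le_trans (ler_wpM2l p0 bin_le).
move: hdeg hCR dC; set B := 'C(n, 2)%:R; lra.
Qed.

Lemma copy_of_independent t (X : {set 'I_n}) : #|X| = t ->
  (forall e, e \in nonedges -> ~~ (e \subset X)) ->
  contains_copy (complete_kgraph k t) H.
Proof.
move=> Xt Xind; apply/existsP.
exists [ffun i : 'I_t => enum_val (cast_ord (esym Xt) i)].
have inj : injective [ffun i : 'I_t => enum_val (cast_ord (esym Xt) i)].
  by move=> i j; rewrite !ffunE => /enum_val_inj/cast_ord_inj.
apply/andP; split; first exact/injectiveP.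
apply/forall_inP => e; rewrite inE => /eqP ek.
set e' := (_ @: _)%SET.
have ek' : #|e'| = k by rewrite card_imset.
have eX : e' \subset X.
  by apply/subsetP => x /imsetP[i _ ->]; rewrite ffunE enum_valP.
by apply: contraTT eX => eH; apply: Xind; rewrite inE ek' eqxx eH.
Qed.

End Complement.

Lemma ex_le (R : realType) k mu t n (p : R) :
  (4 <= k)%N -> (0 < mu)%N -> (0 < t)%N -> (threshold k mu <= t)%N ->
  (16 * (4 * rounds k mu * t) <= n)%N -> 0 <= p -> p <= 1 ->
  (4 * t%:R) ^+ k.-1 * p <= mu%:R ->
  (ex k (k - 2) n (complete_kgraph k t))%:R <= (1 - p) * 'C(n, 2)%:R.
Proof.
move=> k4 mu0 t0 tt nL p0 p1 pmu; rewrite /ex.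
apply: (big_ind (fun m : nat => m%:R <= (1 - p) * 'C(n, 2)%:R)).
- by rewrite mulr_ge0// subr_ge0.
- by move=> x y hx hy; rewrite /maxn; case: ifP.
move=> H /andP[HU]; apply: contraNT; rewrite -ltNge => hdeg.
have [|||||X Xt Xind] := @independent_set R 'I_n (nonedges k H) k mu t p k4 mu0 t0 tt.
- by rewrite card_ord.
- by move=> e; rewrite inE => /andP[/eqP].
- exact: p0.
- exact: pmu.
- by move=> C Ck; apply: nonedges_deg.
exact: copy_of_independent Xt Xind.
Qed.

(** The total operator lim has the value 0 on divergent sequences, which is at
    most c too. *)
Lemma turan_density_le (R : realType) (k l : nat) (W : finType) (F : {set {set W}})
    (c : R) n0 : 0 <= c ->
  (forall n, (n0 <= n)%N -> (ex k l n F)%:R <= c * 'C(n, k - l)%:R) ->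
  turan_density R k l F <= c.
Proof.
move=> c0 h; rewrite /turan_density; set u := (fun n : nat => _).
have [cu|ncu] := boolp.pselect (cvg (u @ \oo)%classic); last by rewrite (dvgP ncu).
apply: limr_le => //; exists n0 => // n /= n0n; rewrite /u.
have [C0|C0] := posnP 'C(n, k - l); first by rewrite C0 invr0 mulr0.
by rewrite ler_pdivrMr ?ltr0n// h.
Qed.

(** * The bound for large t *)

Lemma exp2_le_expR (R : realType) m : (2 ^ m)%:R <= expR m%:R :> R.
Proof.
rewrite -[m%:R]mulr1 expRM_natl natrX; apply: lerXn2r; rewrite ?nnegrE ?expR_ge0//.
by apply: le_trans (expR_ge1Dx 1); lra.
Qed.

Lemma tower_le (R : realType) m t : (0 < t)%N -> 0 < ln t%:R :> R ->
  m%:R <= ln (ln t%:R) :> R -> (2 ^ (2 ^ m) <= t)%N.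
Proof.
move=> t0 l0 ml; rewrite -(ler_nat R).
apply: le_trans (exp2_le_expR R _) _; rewrite -[leRHS]lnK ?posrE ?ltr0n//.
rewrite ler_expR; apply: le_trans (exp2_le_expR R _) _.
by rewrite -[leRHS]lnK ?posrE// ler_expR.
Qed.

Unset Implicit Arguments.

Theorem corollary1p6 (R : realType) (k : nat) (hk : (4 <= k)%N) :
  exists c0 : R, 0 < c0 /\
    exists t0 : nat, forall t : nat, (t0 <= t)%N ->
      turan_density R k (k - 2) (complete_kgraph k t)
        <= 1 - c0 * ln (ln t%:R) / t%:R ^+ (k - 1).
Proof.
pose C := (tower_rate k)%:R : R.
have C0 : 0 < C by rewrite ltr0n.
have k0 : (0 < k)%N by apply: leq_trans hk.
exists (2 * C * 4 ^+ k.-1)^-1; split; first by rewrite invr_gt0 !mulr_gt0 ?exprn_gt0.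
exists (Num.Def.trunc (expR (expR (2 * C)))).+1 => t t0t.
have t_ge : expR (expR (2 * C)) <= t%:R.
  have /andP[_ /ltW h] := truncn_itv (expR_ge0 (expR (2 * C))).
  by apply: le_trans h _; rewrite ler_nat.
have t0 : (0 < t)%N by apply: leq_trans t0t.
have tR : 0 < t%:R :> R by rewrite ltr0n.
have ln_ge : expR (2 * C) <= ln t%:R by rewrite -ler_expR lnK ?posrE.
have ln_gt0 : 0 < ln t%:R :> R by apply: lt_le_trans ln_ge; exact: expR_gt0.
set y := ln (ln t%:R) : R.
have y_ge : 2 * C <= y by rewrite -ler_expR lnK ?posrE.
have yC : 2 <= y / C by rewrite ler_pdivlMr.
(* Up to rounding, the largest mu that threshold_le allows. The constant 2 in c0
   makes up for the rounding, as y / C >= 2. *)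
pose mu := Num.Def.trunc (y / C).
have yC0 : 0 <= y / C by apply: le_trans yC.
have /andP[mu_le mu_gt] := truncn_itv yC0; rewrite -/mu in mu_le mu_gt.
have mu0 : (0 < mu)%N by rewrite truncn_gt0; apply: le_trans yC; lra.
have mu_half : y / (2 * C) <= mu%:R.
  have -> : y / (2 * C) = y / C / 2 by field; rewrite gt_eqF.
  by move: mu_gt; rewrite -natr1; lra.
have tower : (2 ^ (2 ^ (tower_rate k * mu)) <= t)%N.
  by apply: (@tower_le R) => //; rewrite natrM mulrC -ler_pdivlMr.
have tt : (threshold k mu <= t)%N := leq_trans (threshold_le k0 mu0) tower.
have mu_t : (mu <= t)%N.
  apply: leq_trans tower; apply: leq_trans (leq_exp2 _) _; rewrite leq_exp2l//.
  by apply: leq_trans (leq_exp2 _) _; rewrite leq_exp2l// leq_pmull.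
pose p := (2 * C * 4 ^+ k.-1)^-1 * y / t%:R ^+ (k - 1).
have y0 : 0 <= y by apply: le_trans y_ge; rewrite mulr_ge0// ltW.
have p0 : 0 <= p.
  by rewrite divr_ge0 ?exprn_ge0// mulr_ge0// invr_ge0 !mulr_ge0 ?exprn_ge0// ltW.
have pE : (4 * t%:R) ^+ k.-1 * p = y / (2 * C).
  rewrite /p exprMn subn1; field.
  by rewrite !expf_neq0 ?gt_eqF.
have pmu : (4 * t%:R) ^+ k.-1 * p <= mu%:R by rewrite pE.
have p1 : p <= 1.
  have q0 : 0 < (4 * t%:R : R) ^+ k.-1 by rewrite exprn_gt0 ?mulr_gt0.
  rewrite -(ler_pM2l q0) mulr1; apply: le_trans pmu _.
  rewrite -natrM -natrX ler_nat; apply: leq_trans mu_t _.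
  apply: leq_trans (_ : (4 * t) ^ 1 <= _)%N; first by rewrite expn1 leq_pmull.
  rewrite leq_pexp2l ?muln_gt0//.
  by move: hk; clear; lia.
apply: (turan_density_le (n0 := (16 * (4 * rounds k mu * t))%N)).
  by rewrite subr_ge0.
move=> n nL; have -> : (k - (k - 2) = 2)%N by move: hk; clear; lia.
exact: (ex_le hk mu0 t0 tt nL p0 p1 pmu).
Qed.
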